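(* Let $\Pi$ be a Borel probability measure on $\mathbb{R}^D$, let $1\le d\le D$ be an integer, let $j_{\min}\le j_{\max}$ be nonnegative integers, and for each integer $j$ with $j_{\min}\le j\le j_{\max}$ let $\{C_{j,k}\}_{k=1}^{N(j)}$ be a fixed measurable partition of $\mathbb{R}^D$. Suppose there are constants $\theta_1,\theta_2,\theta_3,\theta_4>0$, $\sigma\ge 0$ and $\alpha>0$ (independent of $j,k$) such that for all integers $j_{\min}\le j\le j_{\max}$ and all $k=1,\dots,N(j)$: (A1) $\Pi(C_{j,k})\ge \theta_1 2^{-jd}$; (A2) if $X$ is drawn from $\Pi_{j,k}$ then, almost surely, $\|X-c_{j,k}\|\le \theta_2 2^{-j}$; (A3) the eigenvalues $\lambda^{j,k}_1\ge\dots\ge\lambda^{j,k}_D\ge 0$ of $\Sigma_{j,k}$ satisfy $$\lambda^{j,k}_d\ge \theta_3\frac{2^{-2j}}{d}\quad\text{and}\quad \sum_{l=d+1}^D\lambda^{j,k}_l\le \theta_4\left(\sigma^2+2^{-2(1+\alpha)j}\right)\le \frac12\lambda^{j,k}_d .$$ Let $X,X_1,\dots,X_n$ be an i.i.d. sample from $\Pi$ and set $\bar d:=4d^2\theta_2^4/\theta_3^2$. Then for any integer $j_{\min}\le j\le j_{\max}$ and any $t\ge 1$ such that $t+\log(\bar d\vee 8)\le \frac12\theta_1 n2^{-jd}$, $$\mathbb{E}\|X-\widehat P_j(X)\|^2\le 2\theta_4\left(\sigma^2+2^{-2j(1+\alpha)}\right)+c_1 2^{-2j}\frac{(t+\log(\bar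 d\vee 8))d^2}{n2^{-jd}},$$ and if in addition (A4) there exists $\theta_5>0$ such that $\|\mathrm{Id}-P_j\|_{\infty,\Pi}\le \theta_5\left(\sigma+2^{-(1+\alpha)j}\right)$ for all integers $j_{\min}\le j\le j_{\max}$, then also $$\left\|\mathrm{Id}-\widehat P_j\right\|_{\infty,\Pi}\le \theta_5\left(\sigma+2^{-(1+\alpha)j}\right)+\sqrt{\frac{c_1}{2}2^{-2j}\frac{(t+\log(\bar d\vee 8))d^2}{n2^{-jd}}},$$ with probability (over $X_1,\dots,X_n$) at least $1-\frac{2^{jd+1}}{\theta_1}\left(e^{-t}+e^{-\frac{\theta_1}{16}n2^{-jd}}\right)$, where $$c_1=2\left(12\sqrt2\,\frac{\theta_2^3}{\theta_3\sqrt{\theta_1}}+4\sqrt2\,\frac{\theta_2}{d\sqrt{\theta_1}}\right)^2.$$ (The probability bound applies to the first inequality, and under (A4) also to the second.)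
   Context: $\|\cdot\|$ is the Euclidean norm, $a\vee b=\max(a,b)$, and $\mathrm{Proj}_V$ is the orthogonal projection onto a linear subspace $V$. The support of $\Pi$ is $\mathrm{supp}(\Pi)=\bigcap_{C\text{ closed},\,\Pi(C)=1}C$. For each $j,k$: $\Pi_{j,k}$ is the conditional distribution $\Pi(\cdot\mid C_{j,k})$, $\mathbb{E}_{j,k}$ is expectation with respect to $\Pi_{j,k}$, $c_{j,k}=\mathbb{E}_{j,k}x$, $\Sigma_{j,k}=\mathbb{E}_{j,k}[(x-c_{j,k})(x-c_{j,k})^T]$, and $$V_{j,k}=\operatorname*{argmin}_{\dim V=d}\mathbb{E}_{j,k}\|x-c_{j,k}-\mathrm{Proj}_V(x-c_{j,k})\|^2$$ (minimum over $d$-dimensional linear subspaces; assumed unique), i.e. the span of eigenvectors of $\Sigma_{j,k}$ for its $d$ largest eigenvalues. Set $P_{j,k}(x)=c_{j,k}+\mathrm{Proj}_{V_{j,k}}(x-c_{j,k})$ and $P_j(x)=\sum_{k=1}^{N(j)}I\{x\in C_{j,k}\}P_{j,k}(x)$. Empirical version: given $\mathcal X_n=\{X_1,\dots,X_n\}$, let $\mathcal X_{j,k}=C_{j,k}\cap\mathcal X_n$, $\widehat c_{j,k}=\frac1{|\mathcal X_{j,k}|}\sum_{x\in\mathcal X_{j,k}}x$, $$\widehat V_{j,k}=\operatorname*{argmin}_{\dim V=d}\frac{1}{|\mathcal X_{j,k}|}\sum_{x\in\mathcal X_{j,k}}\|x-\widehat c_{j,k}-\mathrm{Proj}_V(x-\widehat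 c_{j,k})\|^2,$$ $\widehat P_{j,k}(x)=\widehat c_{j,k}+\mathrm{Proj}_{\widehat V_{j,k}}(x-\widehat c_{j,k})$ and $\widehat P_j(x)=\sum_{k=1}^{N(j)}I\{x\in C_{j,k}\}\widehat P_{j,k}(x)$. Errors: $\mathbb{E}\|X-\widehat P_j(X)\|^2:=\int_{\mathrm{supp}(\Pi)}\|x-\widehat P_j(x)\|^2\,d\Pi(x)$ (so the expectation is over $X$ only, and this is a random variable depending on $X_1,\dots,X_n$), and for a map $Q$, $\|\mathrm{Id}-Q\|_{\infty,\Pi}:=\sup_{x\in\mathrm{supp}(\Pi)}\|x-Q(x)\|$.
   Formalization: The second inequality fails at null points of supp(Π) far from c_{j,k}; it is proved for Π-almost every x, and for the supremum over supp(Π) when the bound of (A2) at level j holds at every point of supp(Π)∩C_{j,k}, not only almost surely. *)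

(* Defs.v *)
From HB Require Import structures.
From mathcomp Require Import all_boot all_order all_algebra.
From mathcomp Require Import all_classical all_reals all_analysis.

Set Implicit Arguments.
Unset Strict Implicit.
Unset Printing Implicit Defensive.

Import Order.TTheory GRing.Theory Num.Theory.
Import numFieldNormedType.Exports.

Local Open Scope classical_set_scope.
Local Open Scope ring_scope.

(* R^D with its Borel sigma-algebra; its carrier is convertible to 'rV[R]_D,
   whose (sup-norm) topology is the Euclidean one. *)
Notation borelRV R D := (g_sigma_algebraType (@open 'rV[R]_D)).

Section Euclidean.
Context {R : realType} {D : nat}.

(* The library norm `|x| on 'rV[R]_D is the sup norm. *)
Definition enorm (x : 'rV[R]_D) : R := Num.sqrt (\sum_(i < D) x 0 i ^+ 2).

(* Linear subspaces are row spaces of matrices V : 'M_D, of dimension \rank V.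
   The row space of kermx V^T is {u | u *m V^T = 0}, the orthogonal complement
   of V, so this is the projection onto V along its orthogonal complement; see
   oproj_sub and oproj_ortho below. *)
Definition oproj (V : 'M[R]_D) (x : 'rV[R]_D) : 'rV[R]_D :=
  x *m proj_mx <<V>>%MS (kermx V^T).

Definition affproj (c : 'rV[R]_D) (V : 'M[R]_D) (x : 'rV[R]_D) : 'rV[R]_D :=
  c + oproj V (x - c).

Lemma oproj_sub V x : (oproj V x <= V)%MS.
Proof. by rewrite -(genmxE V) proj_mx_sub. Qed.

Lemma capmx_ker_tr0 (V : 'M[R]_D) : (<<V>> :&: kermx V^T = 0)%MS.
Proof.
apply/eqP/rowV0P => u; rewrite sub_capmx genmxE => /andP[/submxP[w uE]].
move=> /sub_kermxP uV0.
have uu0 : u *m u^T = 0 by rewrite {2}uE trmx_mul mulmxA uV0 mul0mx.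
apply/rowP => i; rewrite mxE; apply/eqP.
have := congr1 (fun M : 'M[R]_1 => M 0 0) uu0; rewrite !mxE.
under eq_bigr do rewrite mxE -expr2.
move/eqP; rewrite psumr_eq0 => [/allP/(_ i)|k _]; last exact: sqr_ge0.
by rewrite mem_index_enum sqrf_eq0 => /(_ isT).
Qed.

Lemma oproj_ortho V x (v : 'rV[R]_D) :
  (v <= V)%MS -> (x - oproj V x) *m v^T = 0.
Proof.
move=> /submxP[w ->]; rewrite trmx_mul mulmxA.
suff /sub_kermxP -> : (x - oproj V x <= kermx V^T)%MS by rewrite mul0mx.
have xVW : (x <= <<V>> + kermx V^T)%MS.
  apply: submx_full; rewrite -col_leq_rank.
  have := mxrank_sum_cap <<V>>%MS (kermx V^T).
  rewrite capmx_ker_tr0 mxrank0 addn0 => ->.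
  by rewrite mxrank_gen mxrank_ker mxrank_tr subnKC// rank_leq_row.
rewrite /oproj -[X in X - _](add_proj_mx (capmx_ker_tr0 V) xVW).
by rewrite addrC addKr proj_mx_sub.
Qed.

(* s lists the eigenvalues of A, with multiplicity, in nonincreasing order. *)
Definition ordered_eigenvalues (A : 'M[R]_D) (s : seq R) : Prop :=
  sorted >=%R s /\ char_poly A = \prod_(z <- s) ('X - z%:P).

End Euclidean.

Record mpartition d (T : measurableType d) := MPartition {
  ncells : nat ;
  cell : 'I_ncells -> set T ;
  cell_measurable : forall k, measurable (cell k) ;
  cell_trivIset : trivIset setT cell ;
  cell_cover : \bigcup_k cell k = setT }.

(* The conditional distribution Pi(. | A); it is Pi itself if Pi A = 0. *)
Definition cond_prob d (T : measurableType d) (R : realType)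
    (Pi : probability T R) (A : set T) (mA : measurable A) :
  probability T R := mnormalize (mrestr Pi mA) Pi.

Section Population.
Context {R : realType} {D : nat}.
Implicit Types (P : probability (borelRV R D) R).

Definition mean P : 'rV[R]_D :=
  \row_i fine 'E_P[fun x : 'rV[R]_D => x 0 i].

Definition covmx P : 'M[R]_D :=
  \matrix_(i, j) fine
    'E_P[fun x : 'rV[R]_D => (x - mean P) 0 i * (x - mean P) 0 j].

Definition pca_risk P (V : 'M[R]_D) : \bar R :=
  'E_P[fun x : 'rV[R]_D => enorm (x - affproj (mean P) V x) ^+ 2].

Definition pca_subspace P (d : nat) (V : 'M[R]_D) : Prop :=
  \rank V = d /\
  forall W : 'M[R]_D, \rank W = d -> (pca_risk P V <= pca_risk P W)%E.

Definition supp P : set 'rV[R]_D :=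
  \bigcap_(A in [set A : set 'rV[R]_D | closed A /\ P A = 1%E]) A.

(* ||Id - Q||_{infty, P} *)
Definition sup_error P (Q : 'rV[R]_D -> 'rV[R]_D) : \bar R :=
  ereal_sup [set (enorm (x - Q x))%:E | x in supp P].

Definition mean_sq_error P (Q : 'rV[R]_D -> 'rV[R]_D) : \bar R :=
  (\int[P]_(x in supp P) (enorm (x - Q x) ^+ 2)%:E)%E.

End Population.

(* Sample points are counted with multiplicity. Over an empty cell all averages
   are 0, so that every d-dimensional subspace is a minimizer there. *)
Section Empirical.
Context {R : realType} {D n : nat}.
Implicit Types (A : set 'rV[R]_D) (x : 'I_n -> 'rV[R]_D).

Definition emp_count A x : nat := #|[pred i | x i \in A]|.

Definition emp_mean A x : 'rV[R]_D :=
  (emp_count A x)%:R^-1 *: \sum_(i < n | x i \in A) x i.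

Definition emp_pca_risk A x (V : 'M[R]_D) : R :=
  (emp_count A x)%:R^-1 *
  \sum_(i < n | x i \in A) enorm (x i - affproj (emp_mean A x) V (x i)) ^+ 2.

Definition emp_pca_subspace A x (d : nat) (V : 'M[R]_D) : Prop :=
  \rank V = d /\
  forall W : 'M[R]_D, \rank W = d -> emp_pca_risk A x V <= emp_pca_risk A x W.

End Empirical.

Section Multiscale.
Context {R : realType} {D : nat} (C : mpartition (borelRV R D)).

Definition cell_prob (Pi : probability (borelRV R D) R) (k : 'I_(ncells C)) :
  probability (borelRV R D) R := cond_prob Pi (cell_measurable k).

Definition piecewise_affproj (c : 'I_(ncells C) -> 'rV[R]_D)
    (V : 'I_(ncells C) -> 'M[R]_D) (x : 'rV[R]_D) : 'rV[R]_D :=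
  \sum_(k < ncells C) \1_(cell k) x *: affproj (c k) (V k) x.

End Multiscale.

Definition iid_sample d (Omega : measurableType d) d' (T : measurableType d')
    (R : realType) (P : probability Omega R) (Pi : probability T R) (n : nat)
    (X : 'I_n -> {mfun Omega >-> T}) : Prop :=
  (forall i (A : set T), measurable A -> P (X i @^-1` A) = Pi A) /\
  (forall A : 'I_n -> set T, (forall i, measurable (A i)) ->
     P (\bigcap_i (X i @^-1` A i)) =
     (\prod_(i < n) fine (P (X i @^-1` A i)))%:E).

(* Main.v *)
(* Fix a cell A of probability p, with conditional mean c, covariance S and
   radius r, put Y = X - c and q^2 = 2 s / (n p) with s = t + log (dbar \/ 8).
   The operator norm can be replaced by the Frobenius norm throughout, so no
   matrix concentration inequality is needed: a Bernstein inequality for sums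
   of i.i.d. vectors in a Euclidean space, from Pinelis' supermartingale
   cosh |lambda (f(X_1) + ... + f(X_k))|, controls the number of sample points
   in A, the sum of the Y_i in A and the sum of the matrices Y_i^T Y_i - S.

   The projection M onto the top d eigenvectors of S satisfies
     gap / 2 * |M - N|^2 <= tr (S (M - N))
   for every orthogonal projection N of rank d. Since the empirical projection
   maximizes the empirical analogue of tr (S N), this yields
     |M - N| <= 2 / gap * |empirical covariance - S|
   for it, and the error of the empirical affine projection exceeds that of the
   population one by at most (12 kappa + 4) r q, where
   kappa = d theta2^2 / theta3. Summing over the at most 2^(jd) / theta1 cells
   gives the theorem. *)

Require Import Defs.
From HB Require Import structures.
From mathcomp Require Import all_boot all_order all_algebra.
From mathcomp Require Import all_classical all_reals all_analysis.
From mathcomp Require Import measurable_realfun ring lra.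

Set Implicit Arguments.
Unset Strict Implicit.
Unset Printing Implicit Defensive.

Import Order.TTheory GRing.Theory Num.Theory.
Import numFieldNormedType.Exports.

Local Open Scope classical_set_scope.
Local Open Scope ring_scope.

(** * Frobenius inner product and norm *)

Section FrobeniusNorm.
Context {R : rcfType}.

(** The Frobenius norm is affordable because [r ^+ 4] bounds the second moment of [Y^T Y] in that
    norm too: the squared entries of [Y^T Y] sum to the fourth power of the norm of [Y], so no
    factor depending on [D] appears.

    The constant 12 is a budget. Measured against [r ^+ 2 * q], the matrix sum contributes 9/4 to
    the error of the empirical covariance and the squared shift of the mean contributes 3/4. The
    factor [4 / lambda_d], which is 2 over the gap [lambda_d / 2], turns their sum 3 into
    [12 * kappa * q]. Both contributions are this small only if [12 * q <= 1]; otherwise the claimed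
    bound already exceeds the trivial one, and the proof splits at this value.

    (A2) is an almost sure bound, while the supermartingale step asks for bounds at every point;
    truncating by the indicator of the ball of (A2) reconciles the two. The good event speaks only
    of sums over the sample, so it is measurable however the empirical subspaces are selected. *)

Lemma sum_Cauchy_Schwarz (I : finType) (a b : I -> R) :
  (\sum_i a i * b i) ^+ 2 <= (\sum_i a i ^+ 2) * (\sum_i b i ^+ 2).
Proof.
set A := \sum_i a i ^+ 2; set B := \sum_i b i ^+ 2; set c := \sum_i a i * b i.
have B0 : 0 <= B by apply: sumr_ge0 => i _; exact: sqr_ge0.
(* [B a - c b] is [B] times the component of [a] orthogonal to [b]. *)
have : 0 <= \sum_i (B * a i - c * b i) ^+ 2.
  by apply: sumr_ge0 => i _; exact: sqr_ge0.
have -> : \sum_i (B * a i - c * b i) ^+ 2 = B * (A * B - c ^+ 2).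
  transitivity (\sum_i (B ^+ 2 * a i ^+ 2 + (- 2 * B * c) * (a i * b i)
                        + c ^+ 2 * b i ^+ 2)).
    by apply: eq_bigr => i _; ring.
  by rewrite !big_split/= -!mulr_sumr -/A -/B -/c; ring.
have [B0' _|Bneq0] := eqVneq B 0; last first.
  by rewrite pmulr_rge0 ?lt_neqAle 1?eq_sym ?Bneq0// subr_ge0.
rewrite B0' mulr0; suff -> : c = 0 by rewrite expr0n.
apply: big1 => i _; suff -> : b i = 0 by rewrite mulr0.
move/eqP: B0'; rewrite psumr_eq0 => [/allP/(_ i)|k _]; last exact: sqr_ge0.
by rewrite mem_index_enum sqrf_eq0 => /(_ isT)/eqP.
Qed.

(** Rectangular matrices are allowed so that row vectors and square matrices share one inner
    product; on rows [fnorm] is the Euclidean norm. *)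
Definition fdot m n (A B : 'M[R]_(m, n)) : R := \tr (A *m B^T).

Definition fnorm m n (A : 'M[R]_(m, n)) : R := Num.sqrt (fdot A A).

Lemma fdotE m n (A B : 'M[R]_(m, n)) :
  fdot A B = \sum_i \sum_j A i j * B i j.
Proof.
apply: eq_bigr => i _; rewrite mxE.
by apply: eq_bigr => j _; rewrite mxE.
Qed.

Lemma fdotC m n (A B : 'M[R]_(m, n)) : fdot A B = fdot B A.
Proof.
by rewrite !fdotE; apply: eq_bigr => i _; apply: eq_bigr => j _; rewrite mulrC.
Qed.

Lemma fdotDl m n (A B C : 'M[R]_(m, n)) :
  fdot (A + B) C = fdot A C + fdot B C.
Proof. by rewrite /fdot mulmxDl mxtraceD. Qed.

Lemma fdotNl m n (A B : 'M[R]_(m, n)) : fdot (- A) B = - fdot A B.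
Proof. by rewrite /fdot mulNmx linearN. Qed.

Lemma fdotZl m n a (A B : 'M[R]_(m, n)) : fdot (a *: A) B = a * fdot A B.
Proof. by rewrite /fdot -scalemxAl linearZ. Qed.

Lemma fdotDr m n (A B C : 'M[R]_(m, n)) :
  fdot C (A + B) = fdot C A + fdot C B.
Proof. by rewrite fdotC fdotDl !(fdotC C). Qed.

Lemma fdotNr m n (A B : 'M[R]_(m, n)) : fdot A (- B) = - fdot A B.
Proof. by rewrite fdotC fdotNl fdotC. Qed.

Lemma fdotZr m n a (A B : 'M[R]_(m, n)) : fdot A (a *: B) = a * fdot A B.
Proof. by rewrite fdotC fdotZl fdotC. Qed.

Lemma fdot_ge0 m n (A : 'M[R]_(m, n)) : 0 <= fdot A A.
Proof.
rewrite fdotE; apply: sumr_ge0 => i _; apply: sumr_ge0 => j _.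
by rewrite -expr2 sqr_ge0.
Qed.

Lemma fdot_eq0 m n (A : 'M[R]_(m, n)) : (fdot A A == 0) = (A == 0).
Proof.
apply/idP/eqP => [|->]; last by rewrite /fdot mul0mx mxtrace0.
rewrite fdotE psumr_eq0 => [/allP H|i _]; last first.
  by apply: sumr_ge0 => j _; rewrite -expr2 sqr_ge0.
apply/matrixP => i j; rewrite mxE; apply/eqP.
have := H i; rewrite mem_index_enum => /(_ isT)/=.
rewrite psumr_eq0 => [/allP/(_ j)|k _]; last by rewrite -expr2 sqr_ge0.
by rewrite mem_index_enum -expr2 sqrf_eq0 => /(_ isT).
Qed.

Lemma fnorm_ge0 m n (A : 'M[R]_(m, n)) : 0 <= fnorm A.
Proof. exact: sqrtr_ge0. Qed.

Lemma fnorm2 m n (A : 'M[R]_(m, n)) : fnorm A ^+ 2 = fdot A A.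
Proof. by rewrite sqr_sqrtr// fdot_ge0. Qed.

Lemma fnormN m n (A : 'M[R]_(m, n)) : fnorm (- A) = fnorm A.
Proof. by rewrite /fnorm fdotNl fdotNr opprK. Qed.

Lemma fnormZ m n a (A : 'M[R]_(m, n)) : 0 <= a -> fnorm (a *: A) = a * fnorm A.
Proof.
move=> a0; rewrite /fnorm fdotZl fdotZr mulrA -expr2 sqrtrM ?sqr_ge0//.
by rewrite sqrtr_sqr ger0_norm.
Qed.

Lemma fdot_le_fnorm m n (A B : 'M[R]_(m, n)) : fdot A B <= fnorm A * fnorm B.
Proof.
rewrite /fnorm -sqrtrM ?fdot_ge0//.
rewrite (le_trans (ler_norm _))// -sqrtr_sqr ler_sqrt ?mulr_ge0 ?fdot_ge0//.
rewrite !fdotE !pair_bigA/=.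
exact: (sum_Cauchy_Schwarz (fun p => A p.1 p.2) (fun p => B p.1 p.2)).
Qed.

Lemma fnormD m n (A B : 'M[R]_(m, n)) : fnorm (A + B) <= fnorm A + fnorm B.
Proof.
rewrite -(@ler_pXn2r _ 2)// ?nnegrE ?addr_ge0 ?fnorm_ge0//.
rewrite fnorm2 fdotDl !fdotDr (fdotC B A) sqrrD !fnorm2.
by have := fdot_le_fnorm A B; lra.
Qed.

Lemma fnormB m n (A B : 'M[R]_(m, n)) : fnorm (A - B) <= fnorm A + fnorm B.
Proof. by rewrite -(fnormN B); exact: fnormD. Qed.

(** Cauchy-Schwarz in each column of [A]: the Frobenius norm dominates the operator norm. *)
Lemma fnorm_mulmx n (x : 'rV[R]_n) (A : 'M[R]_n) :
  fnorm (x *m A) <= fnorm x * fnorm A.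
Proof.
rewrite /fnorm -sqrtrM ?fdot_ge0// ler_sqrt ?mulr_ge0 ?fdot_ge0//
  !fdotE !big_ord1.
rewrite [X in _ <= _ * X]exchange_big mulr_sumr /=.
apply: ler_sum => j _; rewrite mxE -expr2.
apply: (le_trans (sum_Cauchy_Schwarz _ _)).
by apply: ler_wpM2l => //; apply: sumr_ge0 => i _; exact: sqr_ge0.
Qed.

Lemma fdot_mulmx_sym n (x y : 'rV[R]_n) (M : 'M[R]_n) :
  M^T = M -> fdot (x *m M) y = fdot x (y *m M).
Proof. by move=> sM; rewrite /fdot trmx_mul sM mulmxA. Qed.

(** Turns a quadratic form into a trace against a rank-one matrix, so that summing over points
    yields a covariance. *)
Lemma fdot_row_mulmx n (x y : 'rV[R]_n) (M : 'M[R]_n) :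
  fdot x (y *m M) = \tr (x^T *m y *m M).
Proof.
by rewrite /fdot -mulmxA [RHS]mxtrace_mulC -[RHS]mxtrace_tr !trmx_mul trmxK.
Qed.

End FrobeniusNorm.

(** * Orthogonal projections as symmetric idempotent matrices *)

Section OrthogonalProjection.
Context {R : rcfType} {n : nat}.
Implicit Types (M N : 'M[R]_n) (x y : 'rV[R]_n).

Definition ortho_proj M := M^T = M /\ M *m M = M.

(** In a full-rank factorization [M = C B], idempotence gives [C (B C) B = C B]; cancelling [C] and
    [B] leaves [B C = 1], whose trace is the rank. Dimensions can thus be handled by the linear
    functional [\tr]. *)
Lemma mxtrace_idempotent M : M *m M = M -> \tr M = (\rank M)%:R.
Proof.
move=> MM; set C := col_base M; set B := row_base M.
have CB : C *m B = M by exact: mulmx_base.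
have BC1 : B *m C = 1%:M.
  have CBCB : C *m (B *m C *m B) = C *m B.
    by rewrite mulmxA [C *m (B *m C)]mulmxA CB -mulmxA CB MM.
  apply: (row_free_inj (row_base_free M)); rewrite /= mul1mx.
  exact: (row_full_inj (col_base_full M) CBCB).
by rewrite -{1}CB mxtrace_mulC BC1 mxtrace1.
Qed.

Lemma fdot_ortho_proj x M : ortho_proj M -> fdot (x *m M) (x *m M) =
  fdot x (x *m M).
Proof. by case=> sM MM; rewrite fdot_mulmx_sym// -mulmxA MM. Qed.

Lemma fdot_ortho_projC x M : ortho_proj M ->
  fdot (x - x *m M) (x - x *m M) = fdot x x - fdot x (x *m M).
Proof.
move=> PM; rewrite fdotDl !fdotDr !fdotNl !fdotNr fdot_ortho_proj//.
by rewrite (fdotC (x *m M)); ring.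
Qed.

Lemma fnorm_ortho_projC x M : ortho_proj M -> fnorm (x - x *m M) <= fnorm x.
Proof.
move=> PM; rewrite /fnorm ler_sqrt ?fdot_ge0// fdot_ortho_projC//.
by rewrite -fdot_ortho_proj// gerBl fdot_ge0.
Qed.

(* The reflections 2M - 1 and 2N - 1 are isometries, and M - N is half their
   difference. *)
Lemma fnorm_ortho_projB x M N : ortho_proj M -> ortho_proj N ->
  fnorm (x *m (M - N)) <= fnorm x.
Proof.
have refl K : ortho_proj K -> fnorm (x *m (2 *: K - 1%:M)) = fnorm x.
  move=> PK; rewrite /fnorm mulmxBr mulmx1 -scalemxAr.
  rewrite fdotDl !fdotDr !fdotNl !fdotNr !fdotZl !fdotZr fdot_ortho_proj//.
  by rewrite (fdotC (x *m K)); congr Num.sqrt; ring.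
move=> PM PN.
have -> : x *m (M - N) =
    2^-1 *: (x *m (2 *: M - 1%:M) - x *m (2 *: N - 1%:M)).
  rewrite -mulmxBr scalemxAr; congr (_ *m _).
  rewrite opprD opprK addrACA [- 1%:M + _]addrC subrr addr0 -scalerBr scalerA.
  by rewrite mulVf ?scale1r// pnatr_eq0.
rewrite fnormZ ?invr_ge0// ler_pdivrMl//.
by apply: (le_trans (fnormB _ _)); rewrite !refl//; lra.
Qed.

Lemma fdot_ortho_projBB M N : ortho_proj M -> ortho_proj N ->
  fdot (M - N) (M - N) = \tr M + \tr N - 2 * \tr (M *m N).
Proof.
move=> [sM MM] [sN NN]; rewrite fdotDl !fdotDr !fdotNl !fdotNr.
rewrite (fdotC N M) /fdot sM sN MM NN; ring.
Qed.

End OrthogonalProjection.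

(** * Diagonalization of real symmetric matrices *)

Section Spectral.
Context {R : rcfType}.

(* The Householder reflection in the hyperplane orthogonal to u - v. *)
Lemma householder n (u v : 'rV[R]_n) : fdot u u = fdot v v ->
  exists H : 'M[R]_n, [/\ H^T = H, H *m H = 1%:M & u *m H = v].
Proof.
move=> uv; have [->|uneqv] := eqVneq u v.
  by exists 1%:M; rewrite trmx1 !mulmx1.
pose w := u - v; pose c := fdot w w.
have c0 : c != 0 by rewrite fdot_eq0 subr_eq0.
have wwT : w *m w^T = c%:M.
  by rewrite [LHS]mx11_scalar /c /fdot /mxtrace big_ord1.
exists (1%:M - (2 / c) *: (w^T *m w)); split.
- by rewrite linearB/= linearZ/= trmx1 trmx_mul trmxK.
- set K := w^T *m w.
  have KK : K *m K = c *: K.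
    by rewrite /K mulmxA -(mulmxA w^T) wwT mul_mx_scalar -scalemxAl.
  rewrite mulmxBl mul1mx mulmxBr mulmx1 -scalemxAl -scalemxAr KK !scalerA.
  rewrite opprB -!(scaleNr _ K) -addrA -!scalerDl.
  rewrite [X in X *: K](_ : _ = 0) ?scale0r ?addr0//; field; exact: c0.
have uw : u *m w^T = (c / 2)%:M.
  rewrite [LHS]mx11_scalar; congr (_%:M).
  have -> : (u *m w^T) 0 0 = fdot u w by rewrite /fdot /mxtrace big_ord1.
  by rewrite /c /w fdotDl !fdotDr !fdotNl !fdotNr -uv (fdotC v u); field.
rewrite mulmxBr mulmx1 -scalemxAr mulmxA uw mul_scalar_mx scalerA.
rewrite (_ : 2 / c * (c / 2) = 1); last by field.
by rewrite scale1r /w opprB addrC subrK.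
Qed.

Lemma char_poly_simmx n (P A : 'M[R]_n) : P *m P = 1%:M ->
  char_poly (P *m A *m P) = char_poly A.
Proof.
move=> PP; rewrite /char_poly.
pose Q := map_mx polyC P.
have QQ : Q *m Q = 1%:M by rewrite -map_mxM PP map_mx1.
have -> : char_poly_mx (P *m A *m P) = Q *m char_poly_mx A *m Q.
  rewrite /char_poly_mx mulmxBr mulmxBl -!map_mxM; congr (_ - _).
  by rewrite mul_mx_scalar -scalemxAl QQ scale_scalar_mx mulr1.
by rewrite !det_mulmx mulrAC -det_mulmx QQ det1 mul1r.
Qed.

(** Induction on the size: a reflection carries a unit eigenvector for the first listed root to the
    first basis vector, symmetry then splits off a block of size 1, and cancelling ['X - z] leaves
    the tail of [s] for the other block. The diagonal therefore follows the order of [s]. *)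
Lemma symmetric_diagonalizable n (A : 'M[R]_n) (s : seq R) : A^T = A ->
  char_poly A = \prod_(z <- s) ('X - z%:P) ->
  exists Q : 'M[R]_n, Q *m Q^T = 1%:M /\
    A = Q^T *m diag_mx (\row_i s`_i) *m Q.
Proof.
elim: n A s => [|n IH] A s sA cA.
  by exists 1%:M; split; apply/matrixP => -[].
case: s cA => [|z s] cA.
  by have := size_char_poly A; rewrite cA big_nil size_poly1.
have : eigenvalue A z.
  by rewrite eigenvalue_root_char cA big_cons rootM root_XsubC eqxx.
move=> /eigenvalueP[v vA v0].
pose c := fnorm v; have c0 : c != 0.
  by rewrite /c /fnorm sqrtr_eq0 -ltNge lt0r fdot_eq0 v0 fdot_ge0.
pose u := c^-1 *: v.
have uu : fdot u u = 1.
  rewrite /u fdotZl fdotZr -fnorm2 -/c expr2; field; exact: c0.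
have uA : u *m A = z *: u by rewrite /u -scalemxAl vA !scalerA mulrC.
pose e : 'rV[R]_(1 + n) := row_mx 1%:M 0.
have ee : fdot u u = fdot e e.
  rewrite uu /fdot /e tr_row_mx mul_row_col trmx1 mulmx1 trmx0 mulmx0 addr0.
  by rewrite mxtrace1.
have [H [sH HH uH]] := householder ee.
pose B : 'M[R]_(1 + n) := H *m A *m H.
have sB : B^T = B by rewrite /B !trmx_mul sH sA mulmxA.
have eB : e *m B = z *: e.
  by rewrite /B -{1}uH !mulmxA -[u *m H *m H]mulmxA HH mulmx1 uA -scalemxAl uH.
(* [eB] determines the first row of [B], and symmetry its first column. *)
have BE : B = block_mx z%:M 0 0 (drsubmx B).
  move: eB; rewrite -{1}(submxK B) /e mul_row_block !mul1mx !mul0mx !addr0.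
  rewrite scale_row_mx scaler0 scale_scalar_mx mulr1 => /eq_row_mx[Bul Bur].
  rewrite -{1}(submxK B) Bul Bur; congr block_mx.
  by rewrite -[LHS]trmxK trmx_dlsub sB Bur trmx0.
have cB : char_poly (drsubmx B) = \prod_(z0 <- s) ('X - z0%:P).
  have : char_poly B = char_poly A by exact: char_poly_simmx.
  rewrite cA big_cons {1}BE {1}/char_poly char_block_diag_mx det_ublock.
  rewrite (_ : \det (char_poly_mx z%:M) = 'X - z%:P).
    by move=> /mulfI; apply; rewrite polyXsubC_eq0.
  by rewrite det_mx11 !mxE eqxx !mulr1n.
have sB' : (drsubmx B)^T = drsubmx B by rewrite -[in LHS]sB trmx_drsub trmxK.
have [Q [QQ BQ]] := IH _ _ sB' cB.
pose K : 'M[R]_(1 + n) := block_mx 1%:M 0 0 Q.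
have KT : K^T = block_mx 1%:M 0 0 Q^T by rewrite tr_block_mx !trmx0 trmx1.
have KKT : K *m K^T = 1%:M.
  rewrite KT mulmx_block !mulmx0 !mul0mx !addr0 !add0r mulmx1 QQ.
  by rewrite -scalar_mx_block.
pose L : 'M[R]_(1 + n) := diag_mx (\row_(i < n.+1) (z :: s)`_i).
have LE : L = block_mx z%:M 0 0 (diag_mx (\row_(i < n) s`_i)).
  rewrite -[L]submxK; congr block_mx; apply/matrixP => i j; rewrite !mxE.
  - by rewrite !ord1 !eqxx.
  - by rewrite -val_eqE /= (ord1 i).
  - by rewrite -val_eqE /= (ord1 j).
  - by rewrite -!val_eqE/=.
have BKL : B = K^T *m L *m K.
  rewrite BE KT LE !mulmx_block !mulmx0 !mul0mx !addr0 !add0r.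
  by rewrite mul1mx mulmx1 -BQ !mul0mx.
exists (K *m (H : 'M[R]_(1 + n))); split.
  by rewrite trmx_mul sH mulmxA -[_ *m H *m H]mulmxA HH mulmx1.
have -> : A = H *m B *m H.
  by rewrite /B -!mulmxA HH mulmx1 mulmxA HH mul1mx.
by rewrite trmx_mul sH BKL -/L !mulmxA.
Qed.

End Spectral.

(** * Trace inequality from a spectral gap *)

Section SpectralGap.
Context {R : rcfType} {n : nat}.
Implicit Types (A M Q : 'M[R]_n) (s : seq R) (d : nat).

(** For orthogonal [Q], the orthogonal projection onto the span of the first [d] rows of [Q]; these
    rows are eigenvectors of [Q^T *m diag_mx v *m Q]. *)
Definition head_proj Q d : 'M[R]_n :=
  Q^T *m diag_mx (\row_(i < n) ((i < d)%N)%:R) *m Q.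

Lemma mulmx_diag_mxtrace (v : 'rV[R]_n) M :
  \tr (diag_mx v *m M) = \sum_i v 0 i * M i i.
Proof. by apply: eq_bigr => i _; rewrite mul_diag_mx mxE. Qed.

Lemma ortho_proj_conj Q M : Q *m Q^T = 1%:M -> ortho_proj M ->
  ortho_proj (Q *m M *m Q^T).
Proof.
move=> QQ [sM MM]; have QTQ := mulmx1C QQ.
split; first by rewrite !trmx_mul trmxK sM mulmxA.
by rewrite !mulmxA -(mulmxA _ Q^T) QTQ mulmx1 -(mulmxA Q) MM.
Qed.

Lemma mxtrace_conj Q M : Q *m Q^T = 1%:M -> \tr (Q *m M *m Q^T) = \tr M.
Proof.
by move=> QQ; rewrite mxtrace_mulC mulmxA (mulmx1C QQ) mul1mx.
Qed.

(** A diagonal entry equals the squared norm of its row, hence is at least its own square. *)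
Lemma ortho_proj_diag M i : ortho_proj M -> 0 <= M i i <= 1.
Proof.
move=> [sM MM].
have Mii : M i i = \sum_k M i k ^+ 2.
  rewrite -{1}MM mxE; apply: eq_bigr => k _.
  by rewrite -{2}sM mxE expr2.
have : M i i ^+ 2 <= M i i.
  rewrite {2}Mii (bigD1 i)//= lerDl.
  by apply: sumr_ge0 => k _; exact: sqr_ge0.
have : 0 <= M i i by rewrite Mii; apply: sumr_ge0 => k _; exact: sqr_ge0.
by nra.
Qed.

Lemma sum_lt_nat d : (d <= n)%N ->
  \sum_(i < n) ((i < d)%N)%:R = d%:R :> R.
Proof.
move=> dn; rewrite -natr_sum; congr _%:R.
rewrite -(big_mkord xpredT (fun i =>
  (i < d)%N : nat)) (big_cat_nat (leq0n d) dn)/=.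
rewrite big_nat (eq_bigr (fun=> 1%N)); last by move=> i /andP[_ ->].
rewrite -big_nat sum_nat_const_nat muln1 subn0 big_nat big1 ?addn0// => i.
by move=> /andP[di _]; rewrite ltnNge di.
Qed.

Lemma head_proj_ortho Q d : Q *m Q^T = 1%:M -> ortho_proj (head_proj Q d).
Proof.
move=> QQ; rewrite /head_proj -[X in _ *m X]trmxK.
apply: ortho_proj_conj; first by rewrite trmxK (mulmx1C QQ).
split; first by rewrite tr_diag_mx.
rewrite mulmx_diag; congr diag_mx; apply/rowP => i; rewrite !mxE.
by rewrite -natrM mulnb andbb.
Qed.

Lemma mxtrace_head_proj Q d : Q *m Q^T = 1%:M -> (d <= n)%N ->
  \tr (head_proj Q d) = d%:R.
Proof.
move=> QQ dn; rewrite /head_proj mxtrace_mulC mulmxA QQ mul1mx mxtrace_diag.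
by under eq_bigr do rewrite mxE; exact: sum_lt_nat.
Qed.

(* In the eigenbasis M has diagonal entries in [0, 1] summing to d, so trading
   eigenvalues >= a for eigenvalues <= b costs at least a - b per unit mass. *)
Lemma mxtrace_head_proj_gap Q d s M (a b : R) :
  Q *m Q^T = 1%:M -> (d <= n)%N -> ortho_proj M -> \tr M = d%:R ->
  (forall i, (i < d)%N -> a <= s`_i) ->
  (forall i, (d <= i < n)%N -> s`_i <= b) ->
  (a - b) / 2 * fdot (head_proj Q d - M) (head_proj Q d - M) <=
  \tr (Q^T *m diag_mx (\row_i s`_i) *m Q *m (head_proj Q d - M)).
Proof.
move=> QQ dn PM trM sa sb; set A := (X in \tr (X *m _)).
have PW := head_proj_ortho d QQ.
pose N := Q *m M *m Q^T.
have PN : ortho_proj N by exact: ortho_proj_conj.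
have trN : \sum_i N i i = d%:R by rewrite -trM -(mxtrace_conj M QQ).
have conjE v : \tr (Q^T *m diag_mx v *m Q *m M) = \sum_i v 0 i * N i i.
  by rewrite -mulmx_diag_mxtrace /N !mulmxA [RHS]mxtrace_mulC !mulmxA.
have WM : \tr (head_proj Q d *m M) = \sum_(i < n) ((i < d)%N)%:R * N i i.
  by rewrite conjE; apply: eq_bigr => i _; rewrite mxE.
rewrite fdot_ortho_projBB// trM mxtrace_head_proj// WM mulmxBr linearB/=.
rewrite [\tr (A *m M)]conjE.
have -> : \tr (A *m head_proj Q d) = \sum_(i < n) s`_i * ((i < d)%N)%:R.
  rewrite /A /head_proj !mulmxA -(mulmxA _ Q Q^T) QQ mulmx1 mxtrace_mulC.
  rewrite !mulmxA QQ mul1mx mulmx_diag_mxtrace; apply: eq_bigr => i _.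
  by rewrite !mxE eqxx mulr1n.
rewrite (_ : _ * _ = (a - b) * (d%:R - \sum_(i < n) ((i < d)%N)%:R * N i i));
  last by field.
rewrite -subr_ge0 -sumrB.
(* As the diagonal of [N] sums to [d], the mass missing from the first [d] entries equals the mass
   in the others. So [a] can be charged to the former and [b] to the latter, and each summand is
   nonnegative by itself. *)
have -> : \sum_(i < n) (s`_i * ((i < d)%N)%:R - (\row_i0 s`_i0) 0 i * N i i) -
    (a - b) * (d%:R - \sum_(i < n) ((i < d)%N)%:R * N i i) =
  \sum_(i < n) (s`_i * ((i < d)%N)%:R - s`_i * N i i
    - a * (((i < d)%N)%:R - ((i < d)%N)%:R * N i i)
    + b * (N i i - ((i < d)%N)%:R * N i i)).
  rewrite !big_split/= !sumrN -!mulr_sumr !sumrB sum_lt_nat// trN.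
  by under [X in _ - X - _]eq_bigr do rewrite mxE; ring.
apply: sumr_ge0 => i _.
have /andP[N0 N1] := ortho_proj_diag i PN.
case: (ltnP i d) => id /=.
  have := sa i id; rewrite mulr1 !mul1r subrr mulr0 addr0 => asi.
  by rewrite (_ : _ - _ = (s`_i - a) * (1 - N i i)); [nra|ring].
have := sb i; rewrite id ltn_ord => /(_ isT) sib.
rewrite mulr0 !mul0r subr0 mulr0 !sub0r subr0 addrC; nra.
Qed.

Lemma mxtrace_diagonalized Q s : Q *m Q^T = 1%:M ->
  \tr (Q^T *m diag_mx (\row_i s`_i) *m Q) = \sum_(i < n) s`_i.
Proof.
move=> QQ; rewrite mxtrace_mulC mulmxA QQ mul1mx mxtrace_diag.
by under eq_bigr do rewrite mxE.
Qed.

Lemma mxtrace_mul_head_proj Q d s : Q *m Q^T = 1%:M -> (d <= n)%N ->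
  \tr (Q^T *m diag_mx (\row_i s`_i) *m Q *m head_proj Q d) =
  \sum_(0 <= i < d) s`_i.
Proof.
move=> QQ dn; rewrite /head_proj !mulmxA -(mulmxA _ Q Q^T) QQ mulmx1.
rewrite mxtrace_mulC !mulmxA QQ mul1mx mulmx_diag_mxtrace.
rewrite (eq_bigr (fun i : 'I_n => s`_i * ((i < d)%N)%:R)); last first.
  by move=> i _; rewrite !mxE eqxx mulr1n.
rewrite -(big_mkord xpredT (fun i =>
  s`_i * ((i < d)%N)%:R)) (big_cat_nat (leq0n d) dn)/=.
rewrite [X in _ + X]big_nat [X in _ + X]big1 ?addr0; last first.
  by move=> i /andP[di _]; rewrite ltnNge di mulr0.
rewrite big_nat [RHS]big_nat; apply: eq_bigr => i /andP[_ ->].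
by rewrite mulr1.
Qed.

End SpectralGap.

(** * From subspaces to projection matrices *)

Section LibraryProjection.
Context {R : realType} {D : nat}.
Implicit Types (V M : 'M[R]_D) (x : 'rV[R]_D).

Lemma enormE x : enorm x = fnorm x.
Proof.
by rewrite /enorm /fnorm fdotE big_ord1.
Qed.

Definition oproj_mx V : 'M[R]_D := proj_mx <<V>>%MS (kermx V^T).

Lemma oproj_mx_sub V : (oproj_mx V <= V)%MS.
Proof. by rewrite -(genmxE V) -[oproj_mx V]mul1mx proj_mx_sub. Qed.

Lemma mul_oproj_mx V : V *m oproj_mx V = V.
Proof. by rewrite /oproj_mx proj_mx_id ?capmx_ker_tr0// genmxE. Qed.

(** Orthogonality of the residual reads [(1 - M) M^T = 0], that is [M^T = M M^T]; the right side is
    symmetric, hence so is [M]. The rank is that of [V] because [M] has its rows in [V] and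
    [V M = V]. *)
Lemma oproj_mxP V : ortho_proj (oproj_mx V) /\ \tr (oproj_mx V) = (\rank V)%:R.
Proof.
set M := oproj_mx V.
have MM : M *m M = M.
  have /submxP[w Mw] := oproj_mx_sub V.
  by rewrite {1}/M Mw -mulmxA mul_oproj_mx -Mw.
have MMT : M^T = M *m M^T.
  apply/eqP; rewrite -subr_eq0 -{1}[M^T]mul1mx -mulmxBl; apply/eqP.
  apply/matrixP => i j; rewrite [RHS]mxE.
  have : (row i 1%:M - oproj V (row i 1%:M)) *m (row j M)^T = 0.
    by apply: oproj_ortho; rewrite (submx_trans (row_sub _ _)) ?oproj_mx_sub.
  move=> /(congr1 (fun K : 'M[R]_1 => K 0 0)); rewrite [RHS]mxE => <-.
  rewrite /oproj -/(oproj_mx V) -/M -row_mul mul1mx -linearB/= !mxE.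
  by apply: eq_bigr => k _; rewrite !mxE.
have sM : M^T = M by apply: trmx_inj; rewrite {1}MMT trmx_mul trmxK -MMT.
split; first by split.
rewrite mxtrace_idempotent//; congr (_%:R); apply/eqP; rewrite eqn_leq.
by rewrite mxrankS ?oproj_mx_sub//= -{1}(mul_oproj_mx V) mxrankM_maxr.
Qed.

(** Lets a projection matrix stand for its own range, and so enter the minimizations over subspaces
    as a competitor. *)
Lemma oproj_mx_id M : ortho_proj M -> oproj_mx M = M.
Proof.
move=> [sM MM]; have [[sK KK] _] := oproj_mxP M.
have /submxP[w Kw] := oproj_mx_sub M.
have KM : oproj_mx M *m M = oproj_mx M by rewrite Kw -mulmxA MM.
by rewrite -sK -KM trmx_mul sK sM mul_oproj_mx.
Qed.

Lemma affprojE c V x :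
  x - affproj c V x = (x - c) - (x - c) *m oproj_mx V.
Proof. by rewrite /affproj /oproj opprD addrA. Qed.

End LibraryProjection.

(** * Elementary inequalities for exponentials *)

Section ExponentialInequalities.
Context {R : realType}.

(* l encodes the exponential sum with coefficients p.1 and exponents p.2. *)
Lemma expR_sum_ge (l : seq (R * R)) (N : nat) :
  (forall k, (N <= k)%N -> 0 <= \sum_(p <- l) p.1 * p.2 ^+ k) ->
  \sum_(0 <= k < N) (\sum_(p <- l) p.1 * p.2 ^+ k) / k`!%:R <=
  \sum_(p <- l) p.1 * expR p.2.
Proof.
move=> lN.
pose u n := \sum_(p <- l) p.1 * series (exp_coeff p.2) n.
have uE n : u n = \sum_(0 <= k < n) (\sum_(p <- l) p.1 * p.2 ^+ k) / k`!%:R.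
  rewrite /u /series/=; under eq_bigr do rewrite mulr_sumr.
  rewrite exchange_big/=; apply: eq_bigr => k _.
  by rewrite mulr_suml; apply: eq_bigr => p _; rewrite /exp_coeff/= mulrA.
have cu : u @ \oo --> \sum_(p <- l) p.1 * expR p.2.
  rewrite /u; elim: l {lN u uE} => [|p l IH].
    under eq_fun do rewrite big_nil; rewrite big_nil; exact: cvg_cst.
  under eq_fun do rewrite big_cons; rewrite big_cons.
  apply: cvgD => //; apply: cvgM; first exact: cvg_cst.
  by rewrite /expR; exact: is_cvg_series_exp_coeff.
rewrite -(cvg_lim _ cu)//; apply: limr_ge; first by apply/cvg_ex; eexists;
  exact: cu.
(* The Taylor terms from [N] on are nonnegative, so the partial sum up to [N] is a lower bound. *)
near=> n; rewrite uE (@big_cat_nat _ _ _ N 0 n)//=; last by near: n;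
  exact: nbhs_infty_ge.
rewrite lerDl big_nat_cond; apply: sumr_ge0 => k; rewrite andbT => /andP[Nk _].
by rewrite divr_ge0// lN.
Unshelve. all: by end_near. Qed.

(** Twice the hyperbolic cosine: its value 2 at 0 becomes the factor 2 of the tail bound. *)
Definition twocosh (x : R) : R := expR x + expR (- x).

Lemma twocosh_ge0 x : 0 <= twocosh x.
Proof. by rewrite addr_ge0// expR_ge0. Qed.

Lemma twosinh_ge (x : R) : 0 <= x -> 2 * x <= expR x - expR (- x).
Proof.
move=> x0; pose l : seq (R * R) := [:: (1, x); (-1, - x)].
have lN k : (2 <= k)%N -> 0 <= \sum_(p <- l) p.1 * p.2 ^+ k.
  move=> _; rewrite /l big_cons big_seq1/= mul1r mulN1r exprNn subr_ge0.
  rewrite -signr_odd; case: odd; rewrite ?expr0 ?expr1 ?mul1r// mulN1r.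
  by have := exprn_ge0 k x0; lra.
have := expR_sum_ge lN.
rewrite big_nat_recr//= big_nat1 /l !big_cons !big_nil /= !expr0 !expr1.
rewrite fact0 factS fact0 muln1 !invr1; lra.
Qed.

(** Convexity of the power function: the divided difference of [z ^+ m] at [a] is a polynomial in
    [z] with nonnegative coefficients, hence monotone. Multiplied out, it covers coinciding
    points. *)
Lemma exprn_chord (m : nat) (a g b : R) : 0 <= a -> a <= g -> g <= b ->
  (g ^+ m - a ^+ m) * (b - a) <= (b ^+ m - a ^+ m) * (g - a).
Proof.
move=> a0 ag gb; rewrite !subrXX -subr_ge0.
rewrite [X in 0 <= X](_ : _ = (g - a) * (b - a) *
  (\sum_(i < m) b ^+ (m.-1 - i) * a ^+ i - \sum_(i < m) g ^+ (m.-1 - i) *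
    a ^+ i)); last by ring.
rewrite mulr_ge0 ?mulr_ge0 ?subr_ge0//; first exact: le_trans gb.
apply: ler_sum => i _; apply: ler_wpM2r; first exact: exprn_ge0.
by apply: lerXn2r => //; rewrite nnegrE ?(le_trans a0)// (le_trans ag).
Qed.

(* The map z |-> cosh (sqrt z) is convex, having nonnegative Taylor
   coefficients. *)
Lemma twocosh_chord (a g b : R) : 0 <= a -> a <= g -> g <= b ->
  (twocosh g - twocosh a) * (b ^+ 2 - a ^+ 2) <=
  (twocosh b - twocosh a) * (g ^+ 2 - a ^+ 2).
Proof.
move=> a0 ag gb; have g0 := le_trans a0 ag; have b0 := le_trans g0 gb.
pose A := b ^+ 2 - a ^+ 2; pose B := g ^+ 2 - a ^+ 2.
(* The right side minus the left as an exponential sum. Its odd moments cancel, and its even moments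
   are nonnegative by [exprn_chord] at the squares. *)
pose l : seq (R * R) := [:: (B, b); (B, - b); (- A, g); (- A, - g);
  (A - B, a); (A - B, - a)].
have lN k : (0 <= k)%N -> 0 <= \sum_(p <- l) p.1 * p.2 ^+ k.
  move=> _; rewrite /l !big_cons big_nil/= (exprNn b) (exprNn g) (exprNn a).
  rewrite -(signr_odd _ k); have [ko|ke] := boolP (odd k).
    by rewrite expr1; rewrite [X in 0 <= X](_ : _ = 0)//; ring.
  rewrite expr0 !mul1r.
  have -> : k = (2 * k./2)%N by rewrite mul2n even_halfK.
  rewrite !(exprM _ 2 k./2).
  have := @exprn_chord k./2 (a ^+ 2) (g ^+ 2) (b ^+ 2) (sqr_ge0 _).
  rewrite !ler_pXn2r ?nnegrE// => /(_ ag gb).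
  by rewrite -/A -/B; lra.
have := expR_sum_ge lN.
rewrite big_geq// /l !big_cons big_nil/= -/A -/B /twocosh; lra.
Qed.

(* Here a, b and N are the norms of two vectors and of their sum, and c is their
   inner product. The left side is convex in c and the right side affine, so the
   extreme cases c = a b and c = - a b suffice;
     there the claim is b <= sinh b. *)
Lemma twocosh_add_le (a b c N : R) : 0 <= a -> 0 <= b -> 0 <= N ->
  - (a * b) <= c -> c <= a * b -> N ^+ 2 = a ^+ 2 + 2 * c + b ^+ 2 ->
  twocosh N <= twocosh a * (expR b - b) + c * ((expR a - expR (- a)) / a).
Proof.
move=> a0 b0 N0 c1 c2 N2.
have sb := twosinh_ge b0; have sa := twosinh_ge a0.
(* At [a = 0] the quotient by [a] takes the default value 0, and [c = 0] as well. *)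
have [aE|an0] := eqVneq a 0.
  have c0 : c = 0 by move: c1 c2; rewrite aE; lra.
  have -> : N = b.
    by apply/eqP; rewrite -(@eqrXn2 _ 2)// N2 aE c0; apply/eqP; ring.
  rewrite c0 aE mul0r addr0 /twocosh oppr0 expR0; lra.
have agt0 : 0 < a by rewrite lt0r an0.
have [bE|bn0] := eqVneq b 0.
  have c0 : c = 0 by move: c1 c2; rewrite bE; lra.
  have -> : N = a.
    by apply/eqP; rewrite -(@eqrXn2 _ 2)// N2 bE c0; apply/eqP; ring.
  by rewrite c0 bE mul0r addr0 expR0 subr0 mulr1.
have bgt0 : 0 < b by rewrite lt0r bn0.
have abN : `|a - b| <= N.
  rewrite -(@ler_pXn2r _ 2)// ?nnegrE// real_normK ?num_real// N2.
  by move: c1; nra.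
have Nab : N <= a + b.
  rewrite -(@ler_pXn2r _ 2)// ?nnegrE ?addr_ge0// N2.
  by move: c2; nra.
(* [N ^+ 2] is affine in [c] and runs from [(a - b) ^+ 2] to [(a + b) ^+ 2], so the chord
   interpolates between the two extreme cases. *)
have := twocosh_chord (normr_ge0 _) abN Nab.
rewrite real_normK ?num_real// N2.
have -> : twocosh `|a - b| = twocosh (a - b).
  rewrite /twocosh; case: (ger0P (a - b)) => // _.
  by rewrite opprK addrC.
rewrite (_ : (a + b) ^+ 2 - (a - b) ^+ 2 = 4 * (a * b)); last by ring.
rewrite (_ : _ - (a - b) ^+ 2 = 2 * (a * b + c)); last by ring.
have ab0 : 0 < a * b by rewrite mulr_gt0.
move=> H.
rewrite -(ler_pM2r ab0).
have -> : (twocosh a * (expR b - b) + c * ((expR a - expR (- a)) / a)) * (a *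
  b) =
  twocosh a * (expR b - b) * (a * b) + c * b * (expR a - expR (- a)).
  by field.
have eB : twocosh (a - b) = expR a * expR (- b) + expR (- a) * expR b.
  by rewrite /twocosh opprB (addrC b) !expRD.
have eD : twocosh (a + b) = expR a * expR b + expR (- a) * expR (- b).
  by rewrite /twocosh opprD !expRD.
move: H; rewrite eB eD /twocosh.
have := expR_gt0 a; have := expR_gt0 (- a).
have := expR_gt0 b; have := expR_gt0 (- b).
set ea := expR a; set na := expR (- a); set eb := expR b; set nb := expR (- b).
rewrite -/ea -/na -/eb -/nb in sa sb *.
move=> nb0 eb0 na0 ea0 H.
have eana : 0 <= ea - na by lra.
(* [K1] and [K2] are the parts of the remaining slack that carry [na] and [ea]. *)
have K1 : 0 <= (a * b + c) * na * (eb - nb - 2 * b).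
  by apply: mulr_ge0; [apply: mulr_ge0|]; lra.
have K2 : 0 <= (a * b - c) * ea * (eb - nb - 2 * b).
  by apply: mulr_ge0; [apply: mulr_ge0|]; lra.
lra.
Qed.

(** The fourth power of [1 - x / 4 <= expR (- (x / 4))] bounds [expR x] by the inverse of
    [(1 - x / 4) ^+ 4], which leaves a polynomial inequality. The factor 1 stands for the constant
    [K] of the Bernstein inequality. *)
Lemma expR_le_quadr (x : R) : 0 <= x -> x <= 2^-1 ->
  expR x <= 1 + x + 1 * x ^+ 2.
Proof.
move=> x0 x1.
have := expR_ge1Dx (- (x / 4)) => h.
have h4 : (1 - x / 4) ^+ 4 <= expR (- x).
  rewrite [- x](_ : _ = 4%:R * - (x / 4)); last by field.
  by rewrite expRM_natl; apply: lerXn2r => //; rewrite nnegrE; lra.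
have e0 := expR_gt0 x.
have : (1 - x / 4) ^+ 4 * expR x <= 1.
  by rewrite (le_trans (ler_wpM2r (ltW e0) h4))// mulrC expRxMexpNx_1.
have : 1 <= (1 + x + x ^+ 2) * (1 - x / 4) ^+ 4.
  rewrite -subr_ge0.
  rewrite [X in 0 <= X](_ : _ = x ^+ 2 * (3/8 - 11/16 * x + 81/256 * x ^+ 2
    - 15/256 * x ^+ 3 + 1/256 * x ^+ 4)); last by field.
  by apply: mulr_ge0; [exact: sqr_ge0|nra].
set q := (1 - x / 4) ^+ 4 => q1 q2.
have q0 : 0 < q by apply: exprn_gt0; lra.
rewrite mul1r -(ler_pM2l q0).
by rewrite (le_trans q2)// mulrC.
Qed.

(** The same with an eighth power, whose expansion is cut after the cubic term. The constant 5/8 is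
    what permits 9/4 in the deviation of the matrix sum. *)
Lemma expR_le_quadr_small (x : R) : 0 <= x -> x <= 6^-1 ->
  expR x <= 1 + x + 5 / 8 * x ^+ 2.
Proof.
move=> x0 x1.
pose y := x / 8; have xy : x = 8 * y by rewrite /y; field.
have y0 : 0 <= y by rewrite /y; lra.
have y1 : y <= 48^-1 by rewrite /y; lra.
have h := expR_ge1Dx (- y).
have h8 : (1 - y) ^+ 8 <= expR (- x).
  rewrite (_ : - x = 8%:R * - y); last by rewrite xy; ring.
  by rewrite expRM_natl; apply: lerXn2r => //; rewrite nnegrE; lra.
have e0 := expR_gt0 x.
have q1 : (1 - y) ^+ 8 * expR x <= 1.
  by rewrite (le_trans (ler_wpM2r (ltW e0) h8))// mulrC expRxMexpNx_1.
have q3 : 1 - 8 * y + 28 * y ^+ 2 - 56 * y ^+ 3 <= (1 - y) ^+ 8.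
  rewrite -subr_ge0.
  rewrite [X in 0 <= X](_ : _ = y ^+ 4 * (70 - 56 * y
    + y ^+ 2 * (28 - 8 * y) + y ^+ 4)); last by ring.
  apply: mulr_ge0; first exact: exprn_ge0.
  have t1 : 0 <= y ^+ 2 * (28 - 8 * y) by apply: mulr_ge0; [exact: sqr_ge0|lra].
  by have := exprn_ge0 4 y0; lra.
have q2 : 1 <= (1 + 8 * y + 40 * y ^+ 2) *
    (1 - 8 * y + 28 * y ^+ 2 - 56 * y ^+ 3).
  rewrite -subr_ge0.
  rewrite [X in 0 <= X](_ : _ = y ^+ 2 * (4 - 152 * y
    + y ^+ 2 * (672 - 2240 * y))); last by ring.
  apply: mulr_ge0; first exact: sqr_ge0.
  have t2 : 0 <= y ^+ 2 * (672 - 2240 * y) by apply: mulr_ge0;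
    [exact: sqr_ge0|lra].
  lra.
have -> : 1 + x + 5 / 8 * x ^+ 2 = 1 + 8 * y + 40 * y ^+ 2.
  by rewrite xy; field.
have q0 : 0 < (1 - y) ^+ 8 by apply: exprn_gt0; lra.
rewrite -(ler_pM2l q0) (le_trans q1)// (le_trans q2)// [leRHS]mulrC.
apply: ler_wpM2l => //; have := sqr_ge0 y; lra.
Qed.

End ExponentialInequalities.

(** * Independence and integration over one sample point *)

Section IndependentPair.
Local Open Scope ereal_scope.
Context d d1 d2 (Omega : measurableType d) (T1 : measurableType d1)
  (T2 : measurableType d2) (R : realType).
Variables (P : probability Omega R) (Q : probability T2 R).
Variables (Y : {mfun Omega >-> T1}) (X : {mfun Omega >-> T2}).

(** By uniqueness of the product measure, the law of the pair is a product; Tonelli does the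
    rest. *)
Lemma ge0_integral_indep :
  (forall B, measurable B -> P (X @^-1` B) = Q B) ->
  (forall A B, measurable A -> measurable B ->
    P (Y @^-1` A `&` X @^-1` B) = P (Y @^-1` A) * Q B) ->
  forall F : T1 * T2 -> \bar R,
  measurable_fun setT F -> (forall z, 0 <= F z) ->
  \int[P]_w F (Y w, X w) = \int[P]_w \int[Q]_x F (Y w, x).
Proof.
move=> XQ YX F mF F0.
have mZ : measurable_fun setT (fun w => (Y w, X w)).
  by apply: measurable_fun_pair.
pose Z : {mfun Omega >-> (T1 * T2)%type} :=
  HB.pack (fun w => (Y w, X w)) (isMeasurableFun.Build _ _ _ _ _ mZ).
rewrite -[LHS](ge0_integral_distribution Z mF F0).
have e A : measurable A -> (distribution P Y \x Q) A = distribution P Z A.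
  apply: product_measure_unique => {A} A B mA mB.
  by rewrite /distribution /pushforward/= -YX//; congr (P _); apply/seteqP;
    split.
rewrite -(eq_measure_integral _ (fun A mA _ => e A mA)).
rewrite (fubini_tonelli1 _ mF F0) /fubini_F.
rewrite (ge0_integral_distribution Y)//.
  exact: (measurable_fun_fubini_tonelli_F _ mF F0).
by move=> y; exact: integral_ge0.
Qed.

End IndependentPair.

Section Independence.
Context d d' (Omega : measurableType d) (T : measurableType d') (R : realType).
Variables (P : probability Omega R) (Pi : probability T R) (n : nat).
Variable X : 'I_n -> {mfun Omega >-> T}.
Hypothesis hX : iid_sample P Pi X.

(* A pi-system generating the sigma-algebra of X_0, ..., X_(k-1). *)
Definition past (k : nat) : set (set Omega) :=
  [set F | exists A : 'I_n -> set T, [/\ forall i, measurable (A i),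
     forall i : 'I_n, (k <= i)%N -> A i = setT
   & F = \bigcap_i (X i @^-1` A i)]].

Lemma past_setI k : setI_closed (past k).
Proof.
move=> _ _ [A [mA Ak ->]] [B [mB Bk ->]].
exists (fun i => A i `&` B i); split.
- by move=> i; exact: measurableI.
- by move=> i ki; rewrite Ak// Bk// setIT.
- rewrite -bigcapI; apply: eq_bigcapr => i _; exact: preimage_setI.
Qed.

Lemma past_setT k : past k setT.
Proof.
exists (fun=> setT); split => //.
by apply/seteqP; split => // w _ i _.
Qed.

Lemma past_preimage k (i : 'I_n) B : (i < k)%N -> measurable B ->
  past k (X i @^-1` B).
Proof.
move=> ik mB; exists (fun j => if j == i then B else setT); split.
- by move=> j; case: eqP.
- by move=> j kj; case: eqP => // ji; move: ik; rewrite ltnNge -ji kj.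
- apply/seteqP; split => [w Bw j _|w /(_ i I)]; last by rewrite eqxx.
  by case: eqP => [->|].
Qed.

Lemma past_measurable k : past k `<=` measurable.
Proof.
move=> _ [A [mA _ ->]]; apply: fin_bigcap_measurable => // i _.
by rewrite -[X in measurable X]setTI; exact: (measurable_funP (X i)).
Qed.

(** As functions of [F], both sides are finite measures, so it suffices to compare them on the
    pi-system [past k]. There the [k]-th factor is [setT] and can be replaced by [B]. *)
Lemma past_indep (k : 'I_n) F B : <<s past k >> F -> measurable B ->
  P (F `&` X k @^-1` B) = (P F * Pi B)%E.
Proof.
move=> sF mB; have [hd hi] := hX.
have mXB : measurable (X k @^-1` B).
  by rewrite -[Y in measurable Y]setTI; exact: (measurable_funP (X k)).
pose p : {nonneg R} := NngNum (fine_ge0 (measure_ge0 Pi B)).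
have pE : (fine (Pi B))%:E = Pi B by rewrite fineK// fin_num_measure.
transitivity (mscale p P F); last first.
  by rewrite -pE muleC.
rewrite -[LHS]/(mrestr P mXB F).
apply: (g_sigma_algebra_measure_unique (past k) (@past_measurable k)
  (fun=> setT)) => //.
- by move=> _; exact: past_setT.
- by rewrite bigcup_const.
- exact: past_setI.
- move=> _ [A [mA Ak ->]].
  transitivity ((fine (Pi B))%:E * P (\bigcap_i (X i @^-1` A i)))%E; last by [].
  rewrite -[LHS]/(P (\bigcap_i (X i @^-1` A i) `&` X k @^-1` B)).
  have AkT : A k = setT by exact: Ak.
  pose A' i := if i == k then B else A i.
  have mA' i : measurable (A' i) by rewrite /A'; case: eqP.
  have -> : \bigcap_i (X i @^-1` A i) `&` X k @^-1` B =
            \bigcap_i (X i @^-1` A' i).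
    apply/seteqP; split => [w [Aw Bw] i _|w A'w].
      by rewrite /A'; case: eqP => [->//|_]; exact: Aw.
    split=> [i _|].
      have := A'w i I; rewrite /A'; case: eqP => [->|//].
      by rewrite AkT.
    by have := A'w k I; rewrite /A' eqxx.
  rewrite !hi// (bigD1 k)//= [in RHS](bigD1 k)//= /A' eqxx AkT.
  rewrite preimage_setT probability_setT/= mul1r hd// -pE -EFinM.
  congr ((_ * _)%:E); apply: eq_bigr => i /negPf ik.
  by rewrite ik.
- move=> _; rewrite -[ltLHS]/(P (setT `&` X k @^-1` B)) setTI.
  by rewrite -ge0_fin_numE// fin_num_measure.
Qed.

(** [Omega] with the sigma-algebra of the past. The identity into it serves as the random vector of
    the earlier points, so no space of tuples has to be built. *)
Definition past_space k : measurableType (sigma_display (past k)) :=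
  g_sigma_algebraType (past k).

Let past_id_measurable k :
  measurable_fun setT (idfun : Omega -> past_space k).
Proof.
move=> _ F sF; rewrite setTI.
exact: (smallest_sub (@sigma_algebra_measurable _ Omega) (@past_measurable k)).
Qed.

Lemma measurable_past_sample k (i : 'I_n) : (i < k)%N ->
  measurable_fun setT (X i : past_space k -> T).
Proof.
move=> ik _ B mB; rewrite setTI; apply: sub_sigma_algebra.
exact: past_preimage.
Qed.

(** Conditioning on the past without conditional expectations: measurability on [past_space k]
    expresses that [F] depends on [w] only through the earlier points. *)
Lemma ge0_integral_past (k : 'I_n) (F : Omega -> T -> \bar R) :
  measurable_fun setT (fun z : past_space k * T => F z.1 z.2) ->
  (forall w x, 0 <= F w x)%E ->
  (\int[P]_w F w (X k w) = \int[P]_w \int[Pi]_x F w x)%E.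
Proof.
move=> mF F0; have [hd _] := hX.
pose Y : {mfun Omega >-> past_space k} :=
  HB.pack (idfun : Omega -> past_space k)
    (isMeasurableFun.Build _ _ _ _ _ (@past_id_measurable k)).
apply: (@ge0_integral_indep _ _ _ _ _ _ _ P Pi Y (X k) _ _ (fun z =>
  F z.1 z.2)) => //.
- exact: hd.
- move=> A B mA mB; exact: past_indep.
Qed.

End Independence.

(** * Integration of essentially bounded functions *)

Section EssentiallyBounded.
Context d (T : measurableType d) (R : realType) (mu : probability T R).
Implicit Types f g : T -> R.

Lemma ae_imply (p q : T -> Prop) : (forall x, p x -> q x) ->
  {ae mu, forall x, p x} -> {ae mu, forall x, q x}.
Proof. by move=> pq; apply: filterS. Qed.

Lemma ae_imply2 (p q s : T -> Prop) : (forall x, p x -> q x -> s x) ->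
  {ae mu, forall x, p x} -> {ae mu, forall x, q x} -> {ae mu, forall x, s x}.
Proof. by move=> pqs; apply: filterS2. Qed.

Lemma ae_forall_fin (I : finType) (p : T -> I -> Prop) :
  (forall i, {ae mu, forall x, p x i}) -> {ae mu, forall x, forall i, p x i}.
Proof. exact: filter_forall. Qed.

(** Under (A2) coordinates are bounded only almost surely. This class contains them, is closed under
    sums and products, and consists of integrable functions. *)
Definition ess_bounded f :=
  measurable_fun setT f /\ exists M, {ae mu, forall x, `|f x| <= M}.

Lemma ess_bounded_cst (c : R) : ess_bounded (fun=> c).
Proof. by split => //; exists `|c|; exact: aeW. Qed.

Lemma ess_boundedD f g : ess_bounded f -> ess_bounded g ->
  ess_bounded (fun x => f x + g x).
Proof.
move=> [mf [M fM]] [mg [N gN]]; split; first exact: measurable_funD.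
exists (M + N); move: fM gN; apply: filterS2 => x fx gx.
by rewrite (le_trans (ler_normD _ _))// lerD.
Qed.

Lemma ess_boundedM f g : ess_bounded f -> ess_bounded g ->
  ess_bounded (fun x => f x * g x).
Proof.
move=> [mf [M fM]] [mg [N gN]]; split; first exact: measurable_funM.
exists (M * N); move: fM gN; apply: filterS2 => x fx gx.
by rewrite normrM ler_pM.
Qed.

Lemma ess_boundedZ c f : ess_bounded f -> ess_bounded (fun x => c * f x).
Proof. exact/ess_boundedM/ess_bounded_cst. Qed.

Lemma ess_boundedX f n : ess_bounded f -> ess_bounded (fun x => f x ^+ n).
Proof.
move=> bf; elim: n => [|n IH].
  by under eq_fun do rewrite expr0; exact: ess_bounded_cst.
by under eq_fun do rewrite exprS; exact: ess_boundedM.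
Qed.

Lemma ess_boundedB f g : ess_bounded f -> ess_bounded g ->
  ess_bounded (fun x => f x - g x).
Proof.
move=> bf bg; under eq_fun do rewrite -mulN1r.
by apply: ess_boundedD => //; exact: ess_boundedZ.
Qed.

Lemma ess_bounded_sum (I : Type) (r : seq I) (p : pred I) (h : I -> T -> R) :
  (forall i, p i -> ess_bounded (h i)) ->
  ess_bounded (fun x => \sum_(i <- r | p i) h i x).
Proof.
move=> bh; elim: r => [|i r IH].
  by under eq_fun do rewrite big_nil; exact: ess_bounded_cst.
under eq_fun do rewrite big_cons; case pi: (p i) => //.
by apply: ess_boundedD => //; exact: bh.
Qed.

Lemma ess_bounded_integrable f : ess_bounded f ->
  mu.-integrable setT (EFin \o f).
Proof.
move=> [mf [M fM]]; apply/integrableP; split; first exact/measurable_EFinP.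
apply: (@le_lt_trans _ _ ((`|M|)%:E * mu setT)%E); last first.
  by rewrite probability_setT mule1 ltry.
apply: integral_le_bound => //; first exact/measurable_EFinP.
move: fM; apply: filterS => x fx _; rewrite /= lee_fin (le_trans fx)//.
exact: ler_norm.
Qed.

Lemma ess_bounded_integral f : ess_bounded f ->
  (\int[mu]_x (f x)%:E)%E = (\int[mu]_x f x)%:E.
Proof.
move=> bf; rewrite fineK//.
exact: (integrable_fin_num measurableT (ess_bounded_integrable bf)).
Qed.

Lemma RintegralD_bounded f g : ess_bounded f -> ess_bounded g ->
  \int[mu]_x (f x + g x) = \int[mu]_x f x + \int[mu]_x g x.
Proof. by move=> bf bg; rewrite RintegralD//;
  exact: ess_bounded_integrable. Qed.

Lemma RintegralB_bounded f g : ess_bounded f -> ess_bounded g ->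
  \int[mu]_x (f x - g x) = \int[mu]_x f x - \int[mu]_x g x.
Proof. by move=> bf bg; rewrite RintegralB//;
  exact: ess_bounded_integrable. Qed.

Lemma RintegralZ_bounded c f : ess_bounded f ->
  \int[mu]_x (c * f x) = c * \int[mu]_x f x.
Proof. by move=> bf; rewrite RintegralZl//; exact: ess_bounded_integrable. Qed.

Lemma Rintegral_prob_cst (c : R) : \int[mu]_x c = c.
Proof.
rewrite /Rintegral -[RHS]/(fine c%:E) -[in RHS](mule1 c%:E).
by rewrite -(probability_setT mu) -integral_cst.
Qed.

Lemma Rintegral_sum_bounded (I : Type) (r : seq I) (p : pred I)
    (h : I -> T -> R) : (forall i, p i -> ess_bounded (h i)) ->
  \int[mu]_x (\sum_(i <- r | p i) h i x) = \sum_(i <- r | p i) \int[mu]_x h i x.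
Proof.
move=> bh; elim: r => [|i r IH].
  rewrite big_nil; under [LHS]eq_Rintegral do rewrite big_nil.
  exact: Rintegral_prob_cst.
rewrite big_cons; under [LHS]eq_Rintegral do rewrite big_cons.
case pi: (p i) => //.
by rewrite RintegralD_bounded ?IH//; [exact: bh|exact: ess_bounded_sum].
Qed.

Lemma ae_eq_Rintegral f g : measurable_fun setT f -> measurable_fun setT g ->
  {ae mu, forall x, f x = g x} -> \int[mu]_x f x = \int[mu]_x g x.
Proof.
move=> mf mg fg; congr fine.
apply: ae_eq_integral => //; [exact/measurable_EFinP|exact/measurable_EFinP|].
by move: fg; apply: filterS => x -> _.
Qed.

(** [g - f] is replaced by its positive part, which is nonnegative everywhere and almost everywhere
    the same. *)
Lemma ae_le_Rintegral f g : ess_bounded f -> ess_bounded g ->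
  {ae mu, forall x, f x <= g x} -> \int[mu]_x f x <= \int[mu]_x g x.
Proof.
move=> bf bg fg.
rewrite -subr_ge0 -RintegralB_bounded//.
have bgf := ess_boundedB bg bf.
rewrite (@ae_eq_Rintegral _ (fun x => Num.max (g x - f x) 0)).
- by apply: Rintegral_ge0 => x _; rewrite le_max lexx orbT.
- by case: bgf.
- by apply: measurable_maxr => //; case: bgf.
- by move: fg; apply: filterS => x fgx; apply/esym/max_idPl; rewrite subr_ge0.
Qed.

End EssentiallyBounded.

(** * Bernstein inequality for vector-valued sums *)

Section HilbertBernstein.
Context d d' (Omega : measurableType d) (T : measurableType d') (R : realType).
Variables (P : probability Omega R) (Pi : probability T R) (n : nat).
Variable X : 'I_n -> {mfun Omega >-> T}.
Hypothesis hX : iid_sample P Pi X.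
Variables (I : finType) (f : I -> T -> R) (U lambda K v : R).
Hypothesis mf : forall i, measurable_fun setT (f i).
Hypothesis U0 : 0 <= U.
Hypothesis fU : forall x, \sum_i f i x ^+ 2 <= U ^+ 2.
Hypothesis f_centered : forall i, \int[Pi]_x f i x = 0.
Hypothesis f_var : \int[Pi]_x (\sum_i f i x ^+ 2) <= v.
Hypothesis lambda0 : 0 <= lambda.
Hypothesis K0 : 0 <= K.
Hypothesis expK : forall y, 0 <= y -> y <= lambda * U ->
  expR y <= 1 + y + K * y ^+ 2.

(** With [I] equal to [unit], to the coordinates, or to pairs of coordinates, this is the norm of
    the centered count, of the vector sum, and of the matrix sum. *)
Definition l2norm (s : I -> R) : R := Num.sqrt (\sum_i s i ^+ 2).

Let l2norm_ge0 s : 0 <= l2norm s. Proof. exact: sqrtr_ge0. Qed.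

Let l2norm_sqr s : l2norm s ^+ 2 = \sum_i s i ^+ 2.
Proof. by rewrite sqr_sqrtr// sumr_ge0// => i _; exact: sqr_ge0. Qed.

Let f_bounded i : ess_bounded Pi (f i).
Proof.
split => //; exists U; apply: aeW => x.
rewrite -(@ler_pXn2r _ 2)// real_normK ?num_real//.
rewrite (le_trans _ (fU x))// (bigD1 i)//= lerDl.
by apply: sumr_ge0 => j _; exact: sqr_ge0.
Qed.

Let measurable_l2norm d0 (S : measurableType d0) (g : I -> S -> R) :
  (forall i, measurable_fun setT (g i)) ->
  measurable_fun setT (fun x => l2norm (g ^~ x)).
Proof.
move=> mg.
have msqrt : measurable_fun setT (Num.sqrt : R -> R).
  exact: (continuous_measurable_fun (@sqrt_continuous R)).
apply: (measurableT_comp msqrt).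
by apply: measurable_sum => i; exact: measurable_funX.
Qed.

Let measurable_twocosh_l2norm d0 (S : measurableType d0) (g : I -> S -> R) :
  (forall i, measurable_fun setT (g i)) ->
  measurable_fun setT (fun x => twocosh (lambda * l2norm (g ^~ x))).
Proof.
move=> mg; apply: measurable_funD.
  apply: measurableT_comp => //; apply: measurable_funM => //.
  exact: measurable_l2norm.
apply: measurableT_comp => //; apply: measurableT_comp => //.
by apply: measurable_funM => //; exact: measurable_l2norm.
Qed.

(** One step of the supermartingale. [twocosh_add_le] bounds the integrand by a multiple of
    [expR b - b], which is at most [1 + K * b ^+ 2], plus a term linear in [f], which integrates to
    0. *)
Lemma integral_twocosh_add (s : I -> R) :
  (\int[Pi]_x (twocosh (lambda * l2norm (fun i => s i + f i x)))%:E <=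
   (twocosh (lambda * l2norm s) * (1 + K * (lambda ^+ 2 * v)))%:E)%E.
Proof.
set a := lambda * l2norm s; pose ka := (expR a - expR (- a)) / a * lambda ^+ 2.
pose g x := twocosh a * (1 + K * lambda ^+ 2 * \sum_i f i x ^+ 2) +
  ka * \sum_i (s i * f i x).
have bg1 : ess_bounded Pi (fun x => \sum_i f i x ^+ 2).
  by apply: ess_bounded_sum => i _; exact: ess_boundedX.
have bg2 : ess_bounded Pi (fun x => \sum_i s i * f i x).
  by apply: ess_bounded_sum => i _; exact: ess_boundedZ.
have bg3 : ess_bounded Pi (fun x => 1 + K * lambda ^+ 2 * \sum_i f i x ^+ 2).
  by apply: ess_boundedD; [exact: ess_bounded_cst|exact: ess_boundedZ].
have bg : ess_bounded Pi g.
  by apply: ess_boundedD; exact: ess_boundedZ.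
have le_g x : twocosh (lambda * l2norm (fun i => s i + f i x)) <= g x.
  pose b := lambda * l2norm (f ^~ x).
  pose c := lambda ^+ 2 * \sum_i (s i * f i x).
  have a0 : 0 <= a by rewrite mulr_ge0.
  have b0 : 0 <= b by rewrite mulr_ge0.
  have c2 : c ^+ 2 <= (a * b) ^+ 2.
    rewrite /c /a /b mulrACA -expr2 !exprMn; apply: ler_wpM2l.
      by rewrite sqr_ge0.
    by rewrite !l2norm_sqr; exact: sum_Cauchy_Schwarz.
  have /andP[c3 c4] : - (a * b) <= c <= a * b.
    by rewrite -ler_norml -(@ler_pXn2r _ 2) ?nnegrE ?mulr_ge0//
      real_normK ?num_real.
  have N2 : (lambda * l2norm (fun i => s i + f i x)) ^+ 2 =
      a ^+ 2 + 2 * c + b ^+ 2.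
    rewrite /a /b /c !exprMn !l2norm_sqr.
    under eq_bigr do rewrite sqrrD -mulr_natl.
    rewrite !big_split/= -mulr_sumr; ring.
  apply: (le_trans (twocosh_add_le a0 b0 (mulr_ge0 _ _) c3 c4 N2)) => //.
  rewrite /g lerD//; last by rewrite /c /ka; lra.
  apply: ler_wpM2l; first exact: twocosh_ge0.
  have bU : b <= lambda * U.
    by rewrite ler_wpM2l// -(@ler_pXn2r _ 2) ?nnegrE// l2norm_sqr.
  have := expK b0 bU; rewrite /b exprMn l2norm_sqr; lra.
apply: (@le_trans _ _ (\int[Pi]_x (g x)%:E)%E).
  apply: ge0_le_integral => //.
  - by move=> x _; rewrite lee_fin twocosh_ge0.
  - apply/measurable_EFinP; apply: (measurable_twocosh_l2norm (g :=
    fun i x => s i + f i x)) => i.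
    exact: measurable_funD.
  - by apply/measurable_EFinP; case: bg.
  - by move=> x _; rewrite lee_fin.
rewrite (ess_bounded_integral bg) lee_fin /g.
rewrite RintegralD_bounded; [|exact: ess_boundedZ|exact: ess_boundedZ].
rewrite !RintegralZ_bounded// Rintegral_sum_bounded; last first.
  by move=> i _; exact: ess_boundedZ.
rewrite [\sum_(i | true) _]big1 ?mulr0 ?addr0; last first.
  by move=> i _; rewrite RintegralZ_bounded// f_centered mulr0.
rewrite RintegralD_bounded; [|exact: ess_bounded_cst|exact: ess_boundedZ].
rewrite Rintegral_prob_cst RintegralZ_bounded//.
apply: ler_wpM2l; first exact: twocosh_ge0.
by rewrite lerD2l -mulrA ler_wpM2l// ler_wpM2l ?sqr_ge0.
Qed.

Let psum (k : nat) (w : Omega) (i : I) : R :=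
  \sum_(j < n | (j < k)%N) f i (X j w).

(** [psum k] involves the points of index below [k], so the point of index [k] can be integrated out
    with the past frozen; each step costs one factor. *)
Lemma integral_twocosh_psum (k : nat) : (k <= n)%N ->
  (\int[P]_w (twocosh (lambda * l2norm (psum k w)))%:E <=
   (2 * (1 + K * (lambda ^+ 2 * v)) ^+ k)%:E)%E.
Proof.
have v0 : 0 <= v.
  rewrite (le_trans _ f_var)// Rintegral_ge0// => x _.
  by apply: sumr_ge0 => i _; exact: sqr_ge0.
have rho0 : 0 <= 1 + K * (lambda ^+ 2 * v).
  by rewrite addr_ge0// mulr_ge0// mulr_ge0// sqr_ge0.
set rho := 1 + K * (lambda ^+ 2 * v) in rho0 *.
elim: k => [_|k IH kn].
  rewrite (eq_integral (cst 2%:E)) => [|w _].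
    rewrite integral_cst// -[X in (X <= _)%E]/(2%:E * P setT)%E.
    by rewrite probability_setT mule1 expr0 mulr1.
  congr EFin.
  have -> : psum 0 w = (fun=> 0) by apply/funext => i; rewrite /psum big_pred0.
  rewrite /l2norm big1 => [|i _]; last by rewrite expr0n.
  by rewrite sqrtr0 mulr0 /twocosh oppr0 expR0.
pose kk : 'I_n := Ordinal kn.
pose F (w : Omega) (x : T) := twocosh (lambda * l2norm (fun i =>
  psum k w i + f i x)).
have psumS w : psum k.+1 w = (fun i => psum k w i + f i (X kk w)).
  apply/funext => i; rewrite /psum (bigD1 kk)/= ?ltnS// addrC; congr (_ + _).
  apply: eq_bigl => j; rewrite ltnS -val_eqE/= [(j <= k)%N]leq_eqVlt.
  by case: ltngtP.
have mps d0 (S : measurableType d0) (Y : 'I_n -> S -> T) i :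
    (forall j : 'I_n, (j < k)%N -> measurable_fun setT (Y j)) ->
    measurable_fun setT (fun w => \sum_(j < n | (j < k)%N) f i (Y j w)).
  move=> mY; under eq_fun do rewrite big_mkcond.
  apply: measurable_sum => j; case jk: (j < k)%N => //.
  by apply: measurableT_comp => //; exact: mY.
have mF : measurable_fun setT (fun z : past_space X k * T => (F z.1 z.2)%:E).
  apply/measurable_EFinP.
  apply: (@measurable_twocosh_l2norm _ (past_space X k * T)%type
    (fun i z => psum k z.1 i + f i z.2)) => i.
  apply: measurable_funD; last exact: measurableT_comp.
  apply: (measurableT_comp (f := fun w : past_space X k => psum k w i)) => //.
  by apply: mps => j; exact: measurable_past_sample.
have -> : (\int[P]_w (twocosh (lambda * l2norm (psum k.+1 w)))%:E =
           \int[P]_w (F w (X kk w))%:E)%E.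
  by apply: eq_integral => w _; rewrite psumS.
rewrite (ge0_integral_past hX (k := kk) (F := fun w x => (F w x)%:E))//;
  last first.
  by move=> w x; rewrite lee_fin twocosh_ge0.
have mtc : measurable_fun setT (fun w => twocosh (lambda * l2norm (psum k w))).
  by apply: (measurable_twocosh_l2norm (g := fun i w => psum k w i)) => i;
    exact: mps.
apply: (@le_trans _ _ (\int[P]_w (twocosh (lambda * l2norm (psum k w)) *
    rho)%:E)%E).
  apply: ge0_le_integral => //.
  - by move=> w _; apply: integral_ge0 => x _; rewrite lee_fin twocosh_ge0.
  - apply: (measurable_fun_fubini_tonelli_F (m2 := Pi)
      (fun z : Omega * T => (F z.1 z.2)%:E)) => //; last first.
      by move=> z; rewrite lee_fin twocosh_ge0.
    apply/measurable_EFinP.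
    apply: (@measurable_twocosh_l2norm _ (Omega * T)%type
      (fun i z => psum k z.1 i + f i z.2)) => i.
    apply: measurable_funD; last exact: measurableT_comp.
    by apply: (measurableT_comp (f := fun w => psum k w i)) => //; exact: mps.
  - by apply/measurable_EFinP; exact: measurable_funM.
  - by move=> w _; exact: integral_twocosh_add.
under eq_integral do rewrite mulrC EFinM.
rewrite ge0_integralZl//; last 2 first.
- exact/measurable_EFinP.
- by move=> w _; rewrite lee_fin twocosh_ge0.
rewrite exprS mulrCA EFinM lee_wpmul2l// ?lee_fin// IH//.
exact: ltnW.
Qed.

(** Markov's inequality for [twocosh], which dominates [expR], followed by [1 + z <= expR z]. *)
Lemma Bernstein_l2norm (a : R) :
  (P [set w | a < l2norm (fun i => \sum_(j < n) f i (X j w))]%R <=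
   (2 * expR (n%:R * (K * (lambda ^+ 2 * v)) - lambda * a))%:E)%E.
Proof.
set A := [set w | _].
have psumn w : (fun i => \sum_(j < n) f i (X j w)) = psum n w.
  apply/funext => i; rewrite /psum; apply: eq_bigl => j.
  by rewrite ltn_ord.
have mps i : measurable_fun setT (fun w => psum n w i).
  rewrite /psum; under eq_fun do rewrite big_mkcond.
  by apply: measurable_sum => j; rewrite ltn_ord; exact: measurableT_comp.
have mA : measurable A.
  rewrite /A (_ : mkset _ = [set w | a < l2norm (psum n w)]); last first.
    by apply/funext => w /=; rewrite psumn.
  rewrite -[X in measurable X]setTI; apply: measurable_fun_ltr => //.
  exact: (measurable_l2norm (g := fun i w => psum n w i)).
have mtc : measurable_fun setT (fun w => twocosh (lambda * l2norm (psum n w))).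
  exact: (measurable_twocosh_l2norm (g := fun i w => psum n w i)).
have : ((expR (lambda * a))%:E * P A <=
    (2 * (1 + K * (lambda ^+ 2 * v)) ^+ n)%:E)%E.
  apply: le_trans (integral_twocosh_psum (leqnn n)).
  rewrite -integral_cst//.
  apply: (@le_trans _ _ (\int[P]_(w in A) (twocosh (lambda *
    l2norm (psum n w)))%:E)%E).
    apply: ge0_le_integral => //.
    - by move=> w _; rewrite lee_fin expR_ge0.
    - by apply/measurable_EFinP; exact: measurable_funTS.
    - move=> w; rewrite /A /mkset psumn => aw; rewrite lee_fin /twocosh.
      rewrite (@le_trans _ _ (expR (lambda * l2norm (psum n w))))//.
        by rewrite ler_expR ler_wpM2l// ltW.
      by rewrite lerDl expR_ge0.
  apply: ge0_subset_integral => //; first exact/measurable_EFinP.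
  by move=> w _; rewrite lee_fin twocosh_ge0.
rewrite muleC -lee_pdivlMr ?expR_gt0// => /le_trans; apply.
rewrite lee_fin -mulrA; apply: ler_wpM2l => //.
rewrite expRB ler_wpM2r ?invr_ge0 ?expR_ge0// expRM_natl.
apply: lerXn2r; rewrite ?nnegrE ?expR_ge0 ?expR_ge1Dx//.
have v0 : 0 <= v.
  rewrite (le_trans _ f_var)// Rintegral_ge0// => x _.
  by apply: sumr_ge0 => i _; exact: sqr_ge0.
by rewrite addr_ge0// mulr_ge0// mulr_ge0// sqr_ge0.
Qed.

End HilbertBernstein.

(** * Conditional distribution on a cell *)

Section ConditionalProbability.
Context d (T : measurableType d) (R : realType) (Pi : probability T R).
Context (A : set T) (mA : measurable A).
Hypothesis A0 : Pi A != 0%E.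

Let p : R := fine (Pi A).

Let PiA : Pi A = p%:E. Proof. by rewrite fineK// fin_num_measure. Qed.

Let p_gt0 : 0 < p.
Proof. by rewrite lt0r fine_ge0// andbT -eqe -PiA. Qed.

Lemma cond_probE U : cond_prob Pi mA U = (Pi (U `&` A) * (p^-1)%:E)%E.
Proof.
rewrite -[LHS]/((if (Pi (setT `&` A) == 0%E) || (Pi (setT `&` A) == +oo%E)
  then fun U => Pi U
  else fun U => Pi (U `&` A) * ((fine (Pi (setT `&` A)))^-1)%:E)%E U).
by rewrite setTI PiA eqe gt_eqF.
Qed.

Lemma ae_cond_prob (Q : T -> Prop) : {ae cond_prob Pi mA, forall x, Q x} ->
  {ae Pi, forall x, A x -> Q x}.
Proof.
move=> [N [mN N0 QN]]; exists (N `&` A); split.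
- exact: measurableI.
- apply/eqP; move/eqP: N0; rewrite cond_probE mule_eq0 => /orP[//|].
  by rewrite eqe invr_eq0 gt_eqF.
- move=> x /= /not_implyP[Ax nQ]; split => //; exact: QN.
Qed.

Lemma ge0_integral_cond_prob (g : T -> \bar R) : measurable_fun setT g ->
  (forall x, 0 <= g x)%E ->
  (\int[Pi]_(x in A) g x = p%:E * \int[cond_prob Pi mA]_x g x)%E.
Proof.
move=> mg g0.
pose q : {nonneg R} := NngNum (ltW p_gt0).
have mCA : measurable (~` A) by exact: measurableC.
rewrite -[in RHS](setvU A) setUC ge0_integral_setU//; last 2 first.
- exact: measurable_funTS.
- by rewrite disj_set2E setICr.
rewrite [X in (_ + X)%E]null_set_integral//; last 2 first.
- exact: measurable_funTS.
- by rewrite [LHS]cond_probE setICl measure0 mul0e.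
rewrite adde0 -(ge0_integral_mscale (cond_prob Pi mA) mA q)//; last first.
  exact: measurable_funTS.
apply: eq_measure_integral => U mU UA.
transitivity (p%:E * cond_prob Pi mA U)%E; last by [].
rewrite cond_probE setIidl// muleCA -EFinM.
by rewrite mulfV ?mule1// gt_eqF.
Qed.

Lemma Rintegral_cond_prob (g : T -> R) : ess_bounded (cond_prob Pi mA) g ->
  \int[Pi]_x (\1_A x * g x) = p * \int[cond_prob Pi mA]_x g x.
Proof.
move=> bg; have [mg _] := bg.
have intg := ess_bounded_integrable bg.
have mg' : measurable_fun setT (EFin \o g) by exact/measurable_EFinP.
rewrite (@eq_Rintegral _ _ _ _ _ (g \_ A)); last first.
  by move=> x _; rewrite patch_indic mulrC.
rewrite -Rintegral_mkcond /Rintegral integralE [in RHS]integralE.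
rewrite !ge0_integral_cond_prob//;
  do ?[exact: measurable_funepos|exact: measurable_funeneg].
have fp := integrable_pos_fin_num measurableT intg.
have fn := integrable_neg_fin_num measurableT intg.
rewrite -muleBr//; last by rewrite fin_num_adde_defl// fin_numN.
by rewrite fineM//= fin_numB fp.
Qed.

End ConditionalProbability.

(** * Moments of a distribution supported in a ball *)

Section Moments.
Context {R : realType} {D : nat} (nu : probability (borelRV R D) R) (r : R).
Hypothesis r0 : 0 <= r.
Hypothesis nu_r : {ae nu, forall x : 'rV[R]_D, enorm (x - mean nu) <= r}.

Lemma measurable_coord (i : 'I_D) :
  measurable_fun setT (fun x : borelRV R D => (x : 'rV[R]_D) 0 i).
Proof.
apply: (measurability _ (RGenOpens.measurableE R)).
move=> _ [_ [a [b ->] <-]].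
rewrite setTI; apply: sub_sigma_algebra.
have /continuousP := @coord_continuous R 1 D 0 i; apply.
exact: interval_open.
Qed.

Lemma measurable_coordB (c : 'rV[R]_D) (i : 'I_D) :
  measurable_fun setT (fun x : borelRV R D => ((x : 'rV[R]_D) - c) 0 i).
Proof.
under eq_fun do rewrite !mxE.
by apply: measurable_funD => //; exact: measurable_coord.
Qed.

Lemma ler_coord_enorm (x : 'rV[R]_D) (i : 'I_D) : `|x 0 i| <= enorm x.
Proof.
rewrite /enorm -sqrtr_sqr ler_sqrt; last first.
  by apply: sumr_ge0 => k _; exact: sqr_ge0.
by rewrite (bigD1 i)//= lerDl sumr_ge0// => k _; exact: sqr_ge0.
Qed.

Lemma ess_bounded_coordB (i : 'I_D) :
  ess_bounded nu (fun x : borelRV R D => ((x : 'rV[R]_D) - mean nu) 0 i).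
Proof.
split; first exact: measurable_coordB.
exists r; move: nu_r; apply: ae_imply => x; apply: le_trans.
exact: ler_coord_enorm.
Qed.

Lemma Rintegral_coordB (i : 'I_D) :
  \int[nu]_x ((x : 'rV[R]_D) - mean nu) 0 i = 0.
Proof.
have bc : ess_bounded nu (fun x : borelRV R D => (x : 'rV[R]_D) 0 i).
  have := ess_boundedD (ess_bounded_coordB i) (ess_bounded_cst nu (mean nu 0
    i)).
  by congr ess_bounded; apply/funext => x; rewrite !mxE subrK.
rewrite (@eq_Rintegral _ _ _ _ _ (fun x : borelRV R D =>
  (x : 'rV[R]_D) 0 i - mean nu 0 i)).
  rewrite RintegralB_bounded//; last exact: ess_bounded_cst.
  by rewrite Rintegral_prob_cst [mean _ _ _]mxE unlock subrr.
by move=> x _; rewrite !mxE.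
Qed.

Let Y (x : borelRV R D) : 'rV[R]_D := (x : 'rV[R]_D) - mean nu.
Let S := covmx nu.

Let covE i j : S i j = \int[nu]_x (Y x 0 i * Y x 0 j).
Proof. by rewrite mxE unlock. Qed.

Let bY i : ess_bounded nu (fun x => Y x 0 i).
Proof. exact: ess_bounded_coordB. Qed.

Let bYY i j : ess_bounded nu (fun x => Y x 0 i * Y x 0 j).
Proof. exact: ess_boundedM. Qed.

Lemma covmx_sym : S^T = S.
Proof.
apply/matrixP => i j; rewrite [LHS]mxE !covE.
by apply: eq_Rintegral => x _; rewrite mulrC.
Qed.

Let fdot_quadE x (M : 'M[R]_D) : fdot (Y x) (Y x *m M) =
  \sum_i \sum_j M j i * (Y x 0 i * Y x 0 j).
Proof.
rewrite fdotE big_ord1; apply: eq_bigr => i _.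
rewrite [X in _ * X]mxE mulr_sumr; apply: eq_bigr => j _; ring.
Qed.

Lemma ess_bounded_quad (M : 'M[R]_D) :
  ess_bounded nu (fun x => fdot (Y x) (Y x *m M)).
Proof.
under eq_fun do rewrite fdot_quadE.
apply: ess_bounded_sum => i _; apply: ess_bounded_sum => j _.
exact: ess_boundedZ.
Qed.

Lemma Rintegral_quad (M : 'M[R]_D) :
  \int[nu]_x fdot (Y x) (Y x *m M) = \tr (S *m M).
Proof.
under eq_Rintegral do rewrite fdot_quadE.
rewrite Rintegral_sum_bounded; last first.
  by move=> i _; apply: ess_bounded_sum => j _; exact: ess_boundedZ.
apply: eq_bigr => i _; rewrite mxE Rintegral_sum_bounded; last first.
  by move=> j _; exact: ess_boundedZ.
by apply: eq_bigr => j _; rewrite RintegralZ_bounded// covE mulrC.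
Qed.

(** By Pythagoras: minimizing the risk amounts to maximizing the trace of [S] against a
    projection. *)
Lemma pca_riskE (V : 'M[R]_D) :
  pca_risk nu V = (\tr S - \tr (S *m oproj_mx V))%:E.
Proof.
have [PM _] := oproj_mxP V.
rewrite /pca_risk unlock.
rewrite (eq_integral (fun x : borelRV R D =>
   (fdot (Y x) (Y x *m 1%:M) - fdot (Y x) (Y x *m oproj_mx V))%:E)).
  rewrite ess_bounded_integral; last by apply: ess_boundedB;
    exact: ess_bounded_quad.
  rewrite RintegralB_bounded; [|exact: ess_bounded_quad|exact:
    ess_bounded_quad].
  by rewrite !Rintegral_quad mulmx1.
move=> x _; congr EFin.
by rewrite affprojE enormE fnorm2 fdot_ortho_projC// mulmx1.
Qed.

Let sum_sqrYY x : \sum_i \sum_j (Y x 0 i * Y x 0 j) ^+ 2 =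
  (enorm (Y x) ^+ 2) ^+ 2.
Proof.
rewrite /enorm sqr_sqrtr; last by apply: sumr_ge0 => i _; exact: sqr_ge0.
rewrite expr2 mulr_suml; apply: eq_bigr => i _.
by rewrite mulr_sumr; apply: eq_bigr => j _; rewrite exprMn.
Qed.

Lemma covmx_trace_le : \tr S <= r ^+ 2.
Proof.
have -> : \tr S = \int[nu]_x fdot (Y x) (Y x *m 1%:M).
  by rewrite Rintegral_quad mulmx1.
rewrite -[leRHS](Rintegral_prob_cst nu); apply: ae_le_Rintegral.
- exact: ess_bounded_quad.
- exact: ess_bounded_cst.
- move: nu_r; apply: ae_imply => x xr; rewrite mulmx1 -fnorm2 -enormE.
  by rewrite ler_pXn2r// nnegrE// sqrtr_ge0.
Qed.

Lemma Rintegral_sum_sqrYY : \int[nu]_x (\sum_i \sum_j (Y x 0 i *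
  Y x 0 j) ^+ 2) <= r ^+ 4.
Proof.
rewrite -[leRHS](Rintegral_prob_cst nu); apply: ae_le_Rintegral.
- apply: ess_bounded_sum => i _; apply: ess_bounded_sum => j _.
  exact: ess_boundedX.
- exact: ess_bounded_cst.
- move: nu_r; apply: ae_imply => x xr; rewrite sum_sqrYY -exprM.
  by rewrite ler_pXn2r// nnegrE// sqrtr_ge0.
Qed.

Let var_entry i j : \int[nu]_x (Y x 0 i * Y x 0 j - S i j) ^+ 2 =
  \int[nu]_x (Y x 0 i * Y x 0 j) ^+ 2 - S i j ^+ 2.
Proof.
rewrite (@eq_Rintegral _ _ _ _ _ (fun x => (Y x 0 i * Y x 0 j) ^+ 2 +
   ((- 2 * S i j) * (Y x 0 i * Y x 0 j) + S i j ^+ 2))); last first.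
  by move=> x _; ring.
rewrite RintegralD_bounded; [|exact: ess_boundedX|]; last first.
  by apply: ess_boundedD; [exact: ess_boundedZ|exact: ess_bounded_cst].
rewrite RintegralD_bounded; [|exact: ess_boundedZ|exact: ess_bounded_cst].
by rewrite RintegralZ_bounded// -covE Rintegral_prob_cst; ring.
Qed.

(** Entry by entry, the slack is the variance of a product of coordinates. *)
Lemma covmx_sum_sqr_le : \sum_i \sum_j S i j ^+ 2 <= r ^+ 4.
Proof.
rewrite (le_trans _ Rintegral_sum_sqrYY)// Rintegral_sum_bounded; last first.
  by move=> i _; apply: ess_bounded_sum => j _; exact: ess_boundedX.
apply: ler_sum => i _; rewrite Rintegral_sum_bounded; last first.
  by move=> j _; exact: ess_boundedX.
apply: ler_sum => j _; rewrite -subr_ge0 -var_entry.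
by apply: Rintegral_ge0 => x _; exact: sqr_ge0.
Qed.

(** Centering decreases second moments, so the variance keeps the bound [r ^+ 4], although the
    pointwise bound for the centered matrix grows to [2 * r ^+ 2]. *)
Lemma Rintegral_sum_sqr_centered :
  \int[nu]_x (\sum_i \sum_j (Y x 0 i * Y x 0 j - S i j) ^+ 2) <= r ^+ 4.
Proof.
have bc i j : ess_bounded nu (fun x => (Y x 0 i * Y x 0 j - S i j) ^+ 2).
  by apply: ess_boundedX; apply: ess_boundedB => //; exact: ess_bounded_cst.
rewrite (le_trans _ Rintegral_sum_sqrYY)// !Rintegral_sum_bounded; last 2 first.
- by move=> i _; apply: ess_bounded_sum => j _; exact: ess_boundedX.
- by move=> i _; apply: ess_bounded_sum => j _.
apply: ler_sum => i _; rewrite !Rintegral_sum_bounded//; last first.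
  by move=> j _; exact: ess_boundedX.
by apply: ler_sum => j _; rewrite var_entry gerBl sqr_ge0.
Qed.

Lemma sum_sqr_centered_le x : enorm (Y x) <= r ->
  \sum_i \sum_j (Y x 0 i * Y x 0 j - S i j) ^+ 2 <= (2 * r ^+ 2) ^+ 2.
Proof.
move=> xr.
apply: (@le_trans _ _ (2 * (\sum_i \sum_j (Y x 0 i * Y x 0 j) ^+ 2) +
    2 * (\sum_i \sum_j S i j ^+ 2))).
  rewrite !mulr_sumr -big_split/=; apply: ler_sum => i _.
  rewrite !mulr_sumr -big_split/=; apply: ler_sum => j _.
  have := sqr_ge0 (Y x 0 i * Y x 0 j + S i j); lra.
have := covmx_sum_sqr_le.
have : \sum_i \sum_j (Y x 0 i * Y x 0 j) ^+ 2 <= r ^+ 4.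
  by rewrite sum_sqrYY -exprM ler_pXn2r// nnegrE// sqrtr_ge0.
rewrite exprMn -exprM; lra.
Qed.

Lemma covmx_quad_ge0 (v : 'rV[R]_D) : 0 <= (v *m S *m v^T) 0 0.
Proof.
have -> : (v *m S *m v^T) 0 0 = \tr (S *m (v^T *m v)).
  transitivity (\tr (v *m S *m v^T)); first by rewrite /mxtrace big_ord1.
  by rewrite [LHS]mxtrace_mulC [in LHS]mulmxA [LHS]mxtrace_mulC.
rewrite -Rintegral_quad; apply: Rintegral_ge0 => x _.
have -> : fdot (Y x) (Y x *m (v^T *m v)) = (Y x *m v^T) 0 0 ^+ 2.
  rewrite mulmxA [X in X *m v]mx11_scalar mul_scalar_mx fdotZr expr2.
  by congr (_ * _); rewrite /fdot /mxtrace big_ord1.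
exact: sqr_ge0.
Qed.

End Moments.

(** * The population subspace *)

Section PopulationPCA.
Context {R : realType} {D : nat} (nu : probability (borelRV R D) R) (r : R).
Hypothesis r0 : 0 <= r.
Hypothesis nu_r : {ae nu, forall x : 'rV[R]_D, enorm (x - mean nu) <= r}.
Variables (d : nat) (lam : seq R) (V : 'M[R]_D) (theta : R).
Hypotheses (hd1 : (1 <= d)%N) (hdD : (d <= D)%N).
Hypothesis hlam : ordered_eigenvalues (covmx nu) lam.
Hypothesis lamd_gt0 : 0 < lam`_d.-1.
Hypothesis lam_tail : \sum_(d <= l < D) lam`_l <= theta.
Hypothesis lam_gap : theta <= 2^-1 * lam`_d.-1.
Hypothesis hV : pca_subspace nu d V.

Let S := covmx nu.
Let M := oproj_mx V.

(** The eigenvalues being nonnegative, each one in the tail is at most the tail sum, hence at most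
    half of [lambda_d], whose index is [d.-1]. With the gap [lambda_d / 2], the trace inequality at
    [N = M] and the minimality of [V] force [M] to be the projection onto the leading
    eigenvectors. *)
Lemma pca_population : [/\ lam`_d.-1 <= \tr S, (pca_risk nu V <= theta%:E)%E &
  forall N : 'M[R]_D, ortho_proj N -> \tr N = d%:R ->
  lam`_d.-1 / 4 * fdot (M - N) (M - N) <= \tr (S *m (M - N))].
Proof.
have [lam_sorted chi] := hlam; have [rankV minV] := hV.
have [Q [QQ SQ]] := symmetric_diagonalizable (covmx_sym nu) chi.
have size_lam : size lam = D.
  by apply: succn_inj; rewrite -(size_prod_XsubC lam idfun) -chi size_char_poly.
have diagE : Q *m S *m Q^T = diag_mx (\row_i lam`_i).
  by rewrite {1}/S SQ !mulmxA QQ mul1mx -mulmxA QQ mulmx1.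
have lam_ge0 (i : 'I_D) : 0 <= lam`_i.
  have := covmx_quad_ge0 nu_r (row i Q).
  rewrite -row_mul -/S.
  have -> : (row i (Q *m S) *m (row i Q)^T) 0 0 = (Q *m S *m Q^T) i i.
    by rewrite !mxE; apply: eq_bigr => k _; rewrite !mxE.
  by rewrite diagE !mxE eqxx.
have head_ge i : (i < d)%N -> lam`_d.-1 <= lam`_i.
  move=> id; have := @sorted_leq_nth _ >=%R _ _ 0 lam lam_sorted.
  apply; rewrite ?inE ?size_lam//.
  - by move=> a b c; rewrite /= => ba ac; exact: le_trans ba.
  - by move=> a /=.
  - exact: leq_trans id hdD.
  - by rewrite prednK.
  - by rewrite -ltnS prednK.
have tail_le i : (d <= i < D)%N -> lam`_i <= lam`_d.-1 / 2.
  move=> /andP[di iD]; rewrite mulrC; apply: le_trans lam_gap.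
  apply: le_trans lam_tail.
  rewrite (bigD1_seq i)/= ?mem_index_iota ?di ?iD ?iota_uniq//.
  rewrite lerDl big_seq_cond; apply: sumr_ge0 => l.
  rewrite mem_index_iota => /andP[/andP[_ lD] _].
  exact: (lam_ge0 (Ordinal lD)).
have [PM trM] := oproj_mxP V; rewrite rankV in trM.
have PW := head_proj_ortho d QQ; have trW := mxtrace_head_proj QQ hdD.
have gap N : ortho_proj N -> \tr N = d%:R -> lam`_d.-1 / 4 *
    fdot (head_proj Q d - N) (head_proj Q d - N) <=
    \tr (S *m (head_proj Q d - N)).
  move=> PN trN; rewrite /S SQ.
  have := mxtrace_head_proj_gap QQ hdD PN trN head_ge tail_le.
  by rewrite (_ : (_ - _) / 2 = lam`_d.-1 / 4)//; field.
have rankW : \rank (head_proj Q d) = d.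
  by apply/eqP; rewrite -(eqr_nat R) -trW mxtrace_idempotent//; case: PW.
have riskW : \tr S - \tr (S *m head_proj Q d) = \sum_(d <= l < D) lam`_l.
  rewrite {2}/S SQ mxtrace_mul_head_proj// /S SQ mxtrace_diagonalized//.
  rewrite -(big_mkord xpredT (fun i => lam`_i)) (big_cat_nat (leq0n d) hdD)/=.
  lra.
have := minV _ rankW; rewrite !(pca_riskE nu_r) (oproj_mx_id PW) -/S lee_fin.
rewrite -/M => minM.
have WM : head_proj Q d = M.
  apply/eqP; rewrite -subr_eq0 -fdot_eq0 eq_le fdot_ge0 andbT.
  have := gap M PM trM; rewrite mulmxBr linearB/= => gapM.
  have l4 : 0 < lam`_d.-1 / 4 by rewrite divr_gt0.
  by rewrite -(pmulr_rle0 _ l4) (le_trans gapM)// subr_le0; lra.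
split.
- rewrite /S SQ mxtrace_diagonalized//.
  have dD : (d.-1 < D)%N by rewrite prednK.
  rewrite (bigD1 (Ordinal dD))//= lerDl; apply: sumr_ge0 => i _.
  exact: lam_ge0.
- by rewrite lee_fin -WM riskW.
- by move=> N; rewrite -WM; exact: gap.
Qed.

End PopulationPCA.

(** * Perturbation of the empirical subspace *)

Section EmpiricalPCA.
Context {R : realType} {D n : nat}.
Variables (A : set 'rV[R]_D) (x : 'I_n -> 'rV[R]_D) (c : 'rV[R]_D).
Variables (S M V : 'M[R]_D) (d : nat) (g : R).

Let m := emp_count A x.
Let T := \sum_(i < n | x i \in A) ((x i - c)^T *m (x i - c) - S).
Let delta := m%:R^-1 *: \sum_(i < n | x i \in A) (x i - c).

Hypothesis m_gt0 : (0 < m)%N.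

Let m_neq0 : m%:R != 0 :> R. Proof. by rewrite pnatr_eq0 -lt0n. Qed.

Let sum_cst (W : lmodType R) (u : W) :
  \sum_(i < n | x i \in A) u = m%:R *: u.
Proof. by rewrite sumr_const scaler_nat. Qed.

Lemma emp_mean_shift : emp_mean A x = c + delta.
Proof.
rewrite /delta sumrB sum_cst scalerBr scalerA mulVf// scale1r.
by rewrite addrC subrK.
Qed.

(* A Davis-Kahan bound without eigenvectors: M maximizes tr (S M) with margin g
   and the empirical projection maximizes the empirical analogue, so comparing
   each of the two with the other bounds their distance. *)
Lemma emp_projection_perturbation :
  emp_pca_subspace A x d V -> ortho_proj M -> \tr M = d%:R -> 0 < g ->
  (forall N : 'M[R]_D, ortho_proj N -> \tr N = d%:R ->
    g * fdot (M - N) (M - N) <= \tr (S *m (M - N))) ->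
  fnorm (M - oproj_mx V) <= g^-1 * (fnorm T / m%:R + fnorm delta ^+ 2).
Proof.
move=> [rankV minV] PM trM g0 gapM.
have [PN trN] := oproj_mxP V; set N := oproj_mx V in PN trN *.
rewrite rankV in trN.
pose Delta := M - N.
have rankM : \rank M = d.
  by apply/eqP; rewrite -(eqr_nat R) -trM mxtrace_idempotent//; case: PM.
have sDelta : Delta^T = Delta.
  by rewrite linearB/=; case: PM => -> _; case: PN => -> _.
pose y i := (x i - c) - delta.
have yE i : x i - emp_mean A x = y i by rewrite emp_mean_shift opprD addrA.
have riskE W : emp_pca_risk A x W = m%:R^-1 *
   \sum_(i < n | x i \in A) (fdot (y i) (y i) - fdot (y i) (y i *m oproj_mx W)).
  congr (_ * _); apply: eq_bigr => i _; have [PW _] := oproj_mxP W.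
  by rewrite affprojE enormE fnorm2 yE fdot_ortho_projC.
(* Empirical minimality of [V], tested against the range of [M]. *)
have yDelta : \sum_(i < n | x i \in A) fdot (y i) (y i *m Delta) <= 0.
  have := minV M rankM; rewrite !riskE (oproj_mx_id PM) -/N.
  rewrite ler_pM2l ?invr_gt0 ?ltr0n// -subr_ge0 -sumrB => H.
  rewrite -oppr_ge0 -sumrN; apply: le_trans H _; apply: ler_sum => i _.
  by move: (y i) => z; rewrite /Delta mulmxBr fdotDr fdotNr; lra.
have sumY : \sum_(i < n | x i \in A) (x i - c) = m%:R *: delta.
  by rewrite scalerA mulfV// scale1r.
(* Recentering at the empirical mean costs only a term quadratic in [delta]: the cross terms
   contribute it with weight -2, the square with weight 1. *)
have expand : \sum_(i < n | x i \in A) fdot (y i) (y i *m Delta) =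
    fdot T Delta + m%:R * \tr (S *m Delta) - m%:R * fdot delta (delta *m Delta).
  have -> : fdot T Delta + m%:R * \tr (S *m Delta) =
      \sum_(i < n | x i \in A) fdot (x i - c) ((x i - c) *m Delta).
    rewrite /fdot sDelta /T mulmx_suml linear_sum/=.
    rewrite -[m%:R * _]/(m%:R *: (_ : R^o)) -sum_cst -big_split/=.
    apply: eq_bigr => i _.
    by rewrite mulmxBl linearB/= subrK -fdot_row_mulmx.
  transitivity (\sum_(i < n | x i \in A) (fdot (x i - c) ((x i - c) *m Delta)
     - 2 * fdot (x i - c) (delta *m Delta) + fdot delta (delta *m Delta))).
    apply: eq_bigr => i _; rewrite /y; move: (x i - c) => Yi.
    rewrite mulmxBl !fdotDl !fdotDr !fdotNl !fdotNr.
    by rewrite -(fdot_mulmx_sym delta Yi sDelta) (fdotC (delta *m Delta) Yi);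
      ring.
  rewrite big_split/= sumrB (sum_cst (_ : R^o)) -mulr_sumr.
  rewrite -[_ *: _]/(m%:R * _).
  have -> : \sum_(i < n | x i \in A) fdot (x i - c) (delta *m Delta) =
      m%:R * fdot delta (delta *m Delta).
    by rewrite -fdotZl -sumY /fdot mulmx_suml linear_sum.
  ring.
have TD : - (fnorm T * fnorm Delta) <= fdot T Delta.
  by rewrite lerNl -fdotNl -(fnormN T) fdot_le_fnorm.
have dD : fdot delta (delta *m Delta) <= fnorm delta ^+ 2 * fnorm Delta.
  rewrite (le_trans (fdot_le_fnorm _ _))// expr2 -mulrA ler_wpM2l ?fnorm_ge0//.
  exact: fnorm_mulmx.
have m0 : 0 < m%:R :> R by rewrite ltr0n.
have main : g * fnorm Delta ^+ 2 <=
    (fnorm T / m%:R + fnorm delta ^+ 2) * fnorm Delta.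
  rewrite fnorm2 (le_trans (gapM _ PN trN))// -(ler_pM2l m0).
  rewrite mulrA mulrDr mulrCA mulfV// mulr1.
  move: yDelta; rewrite expand => H.
  have := ler_wpM2l (ltW m0) dD; rewrite -/Delta; lra.
rewrite ler_pdivlMl//.
have := fnorm_ge0 Delta; rewrite le_eqVlt => /orP[/eqP D0|D0].
  rewrite -/Delta -D0 mulr0 addr_ge0// ?sqr_ge0// divr_ge0 ?fnorm_ge0//.
by rewrite -(ler_pM2r D0) -mulrA -expr2.
Qed.

End EmpiricalPCA.

(** * Union bound and deviations of the sample in one cell *)

Section FiniteUnion.
Context d (Omega : measurableType d) (R : realType) (P : probability Omega R).

Lemma probability_bigcup_fin_le (I : finType) (B : I -> set Omega) (b : R) :
  (forall i, measurable (B i)) -> (forall i, (P (B i) <= b%:E)%E) ->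
  (P (\bigcup_i B i) <= (#|I|%:R * b)%:E)%E.
Proof.
move=> mB PB.
have -> : \bigcup_i B i = \big[setU/set0]_(i <- enum I) B i.
  rewrite -bigcup_seq; congr bigcup; apply/seteqP; split => i //= _.
  by rewrite mem_enum.
rewrite cardE; elim: (enum I) => [|i s IH].
  by rewrite big_nil measure0 mul0r.
rewrite big_cons.
have ms : measurable (\big[setU/set0]_(j <- s) B j).
  by apply: bigsetU_measurable => j _.
apply: (le_trans (measureU2 _ (mB i) ms)).
by rewrite /= -natr1 mulrDl mul1r addrC EFinD leeD.
Qed.

End FiniteUnion.

Section CellDeviations.
Context d d' (Omega : measurableType d) (T : measurableType d') (R : realType).
Variables (P : probability Omega R) (Pi : probability T R) (n : nat).
Variable X : 'I_n -> {mfun Omega >-> T}.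
Hypothesis hX : iid_sample P Pi X.
Context (A : set T) (mA : measurable A) (G : set T) (mG : measurable G).
Hypothesis A0 : Pi A != 0%E.

Let nu := cond_prob Pi mA.
Let p := fine (Pi A).
Hypothesis nuG : {ae nu, forall x, G x}.

Lemma sqr_indic (B : set T) x : \1_B x ^+ 2 = \1_B x :> R.
Proof. by rewrite indicE; case: (x \in B); rewrite ?expr1n ?expr0n. Qed.

(** [G] has full conditional probability: its indicator leaves the integrals unchanged and turns a
    bound valid on [G] into one valid everywhere, as the Bernstein inequality requires. *)
Lemma Rintegral_indic_cell (g : T -> R) : ess_bounded nu g ->
  \int[Pi]_x (\1_A x * (\1_G x * g x)) = p * \int[nu]_x g x.
Proof.
move=> bg; have [mg [C gC]] := bg.
have mGg : measurable_fun setT (fun x => \1_G x * g x).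
  by apply: measurable_funM => //; exact: measurable_indic.
rewrite (Rintegral_cond_prob A0); last first.
  split => //; exists C; move: gC; apply: ae_imply => x gx.
  rewrite indicE; case: (x \in G); rewrite ?mul1r// mul0r normr0.
  exact: le_trans gx.
congr (_ * _); apply: ae_eq_Rintegral => //.
by move: nuG; apply: ae_imply => x Gx; rewrite indicE mem_set// mul1r.
Qed.

(* The sample is not conditioned on falling into A: the summands are multiplied
   by the indicator of A, which leaves them i.i.d. and centered. *)
Lemma Bernstein_cell (I : finType) (h : I -> T -> R) (U lambda K v a : R) :
  (forall i, ess_bounded nu (h i)) -> 0 <= U ->
  (forall x, G x -> \sum_i h i x ^+ 2 <= U ^+ 2) ->
  (forall i, \int[nu]_x h i x = 0) ->
  \int[nu]_x (\sum_i h i x ^+ 2) <= v ->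
  0 <= lambda -> 0 <= K ->
  (forall y, 0 <= y -> y <= lambda * U -> expR y <= 1 + y + K * y ^+ 2) ->
  (P [set w | a < l2norm (fun i => \sum_(j < n)
      (\1_A (X j w) * (\1_G (X j w) * h i (X j w))))]%R <=
   (2 * expR (n%:R * (K * (lambda ^+ 2 * (p * v))) - lambda * a))%:E)%E.
Proof.
move=> bh U0 hU h0 hv l0 K0 hK.
apply: (Bernstein_l2norm hX (f := fun i x =>
  \1_A x * (\1_G x * h i x)) (U := U)) => //.
- move=> i; apply: measurable_funM; first exact: measurable_indic.
  by apply: measurable_funM; [exact: measurable_indic|case: (bh i)].
- move=> x; have [Gx|nGx] := pselect (G x); last first.
    rewrite big1 ?sqr_ge0// => i _.
    by rewrite [\1_G x]indicE memNset// mul0r mulr0 expr0n.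
  apply: le_trans (hU x Gx); apply: ler_sum => i _.
  rewrite !exprMn !sqr_indic [\1_G x]indicE mem_set// mul1r indicE.
  by case: (x \in A); rewrite ?mul1r// mul0r sqr_ge0.
- by move=> i; rewrite Rintegral_indic_cell// h0 mulr0.
- have bs : ess_bounded nu (fun x => \sum_i h i x ^+ 2).
    by apply: ess_bounded_sum => i _; exact: ess_boundedX.
  rewrite (@eq_Rintegral _ _ _ _ _ (fun x =>
    \1_A x * (\1_G x * \sum_i h i x ^+ 2))).
    by rewrite Rintegral_indic_cell// ler_wpM2l// fine_ge0.
  move=> x _; rewrite !mulr_sumr; apply: eq_bigr => i _.
  by rewrite !exprMn !sqr_indic.
Qed.

(** The variance of the indicator is at most [p]. With [lambda = 1/4] and [K = 1] the exponent is
    [n p (1/16 - 1/8)]. *)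
Lemma Bernstein_count :
  (P [set w | n%:R * p / 2 < l2norm (fun _ : unit => \sum_(j < n)
      (\1_A (X j w) - p))]%R <= (2 * expR (- (n%:R * p / 16)))%:E)%E.
Proof.
have p0 : 0 <= p by rewrite fine_ge0.
have p1 : p <= 1.
  by rewrite -lee_fin fineK ?fin_num_measure// probability_le1.
have b1 : ess_bounded Pi (fun x => \1_A x : R).
  split; first exact: measurable_indic.
  exists 1; apply: aeW => x; rewrite indicE.
  by case: (x \in A); rewrite ?normr1// normr0.
have i1 : \int[Pi]_x (\1_A x : R) = p.
  by rewrite /Rintegral integral_indic// setIT.
have := Bernstein_l2norm hX (I := unit) (f := fun _ x => \1_A x - p)
  (U := 1) (lambda := 4^-1) (K := 1) (v := p).
move=> /(_ _ _ _ _ _ _ _ _ (n%:R * p / 2)) => H.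
have -> : - (n%:R * p / 16) = n%:R * (1 * (4^-1 ^+ 2 * p)) - 4^-1 * (n%:R *
  p / 2).
  by field.
apply: H => //.
- move=> _; apply: measurable_funB => //; exact: measurable_indic.
- move=> x; rewrite big_const card_unit /= addr0 expr1n indicE.
  by case: (x \in A) => /=; nra.
- move=> _; rewrite RintegralB_bounded//; last exact: ess_bounded_cst.
  by rewrite i1 Rintegral_prob_cst subrr.
- rewrite (@eq_Rintegral _ _ _ _ _ (fun x => (1 - 2 * p) * \1_A x + p ^+ 2)).
    rewrite RintegralD_bounded; [|exact: ess_boundedZ|exact: ess_bounded_cst].
    by rewrite RintegralZ_bounded// i1 Rintegral_prob_cst; nra.
  move=> x _; rewrite big_const card_unit /= addr0 sqrrB sqr_indic; ring.
- by move=> y y0 y1; apply: expR_le_quadr => //; lra.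
Qed.

End CellDeviations.

Lemma measurable_enorm d (T : measurableType d) (R : realType) (D : nat)
    (g : T -> 'rV[R]_D) : (forall i, measurable_fun setT (fun x => g x 0 i)) ->
  measurable_fun setT (fun x => enorm (g x)).
Proof.
move=> mg; have msqrt : measurable_fun setT (Num.sqrt : R -> R).
  exact: (continuous_measurable_fun (@sqrt_continuous R)).
apply: (measurableT_comp msqrt).
by apply: measurable_sum => i; exact: measurable_funX.
Qed.

Section CellEvent.
Context d (Omega : measurableType d) (R : realType) (D n : nat).
Variables (P : probability Omega R) (Pi : probability (borelRV R D) R).
Variable X : 'I_n -> {mfun Omega >-> borelRV R D}.
Hypothesis hX : iid_sample P Pi X.
Context (A : set (borelRV R D)) (mA : measurable A).
Hypothesis A0 : Pi A != 0%E.

Let nu := cond_prob Pi mA.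
Let p := fine (Pi A).
Let c := mean nu.
Let S := covmx nu.

Variables (r s : R).
Hypothesis r0 : 0 < r.
Hypothesis nu_r : {ae nu, forall x : 'rV[R]_D, enorm (x - c) <= r}.
Hypothesis s0 : 0 < s.
Hypothesis s_le : 2 * s <= n%:R * p.

(* As n p / 2 bounds the number of sample points in A from below, q bounds
   sqrt (s / m) for that number m. *)
Let q := Num.sqrt (2 * s / (n%:R * p)).
Let xs w : 'I_n -> 'rV[R]_D := fun i => X i w.

(** The complement of [E] consists of one bad event per conclusion. The count gives
    [2 * expR (- (n%:R * p / 16))], leaving the ball is a null event, and the vector and matrix sums
    give [2 * expR (- s)] each. *)
Lemma cell_event : exists E : set Omega, [/\ measurable E,
  (P (~` E) <= (4 * expR (- s) + 2 * expR (- (n%:R * p / 16)))%:E)%E &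
  forall w, E w -> [/\ n%:R * p / 2 <= (emp_count A (xs w))%:R,
    forall i, A (xs w i) -> enorm (xs w i - c) <= r,
    fnorm (\sum_(i < n | xs w i \in A) (xs w i - c)) <= 3 * r * q * (n%:R *
      p / 2) &
    12 * q <= 1 ->
    fnorm (\sum_(i < n | xs w i \in A) ((xs w i - c)^T *m (xs w i - c) - S)) <=
      9 / 4 * r ^+ 2 * q * (n%:R * p / 2)]].
Proof.
pose G : set (borelRV R D) := [set x : 'rV[R]_D | enorm (x - c) <= r].
have mG : measurable G.
  rewrite (_ : G = ~` [set x : borelRV R D | r < enorm ((x : 'rV[R]_D) - c)]).
    apply: measurableC; rewrite -[Z in measurable Z]setTI.
    apply: measurable_fun_ltr => //.
    by apply: measurable_enorm => i; exact: measurable_coordB.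
  by apply/seteqP; split => x /=; rewrite /G /= leNgt => /negP.
pose Y (x : borelRV R D) : 'rV[R]_D := (x : 'rV[R]_D) - c.
have np0 : 0 < n%:R * p by rewrite (lt_le_trans _ s_le)// mulr_gt0.
have q0 : 0 <= q by exact: sqrtr_ge0.
have q2 : q ^+ 2 = 2 * s / (n%:R * p).
  by rewrite sqr_sqrtr// divr_ge0 ?(ltW np0)// mulr_ge0// ltW.
have npq : n%:R * p * q ^+ 2 = 2 * s.
  by rewrite q2 mulrC divfK// gt_eqF.
have q1 : q <= 1.
  by rewrite -(@ler_pXn2r _ 2) ?nnegrE// q2 expr1n ler_pdivrMr// mul1r.
have bY i : ess_bounded nu (fun x =>
  Y x 0 i) by exact: ess_bounded_coordB nu_r i.
pose B1 := [set w | n%:R * p / 2 < l2norm (fun _ : unit => \sum_(j < n)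
      (\1_A (X j w) - p))].
pose B2 := \bigcup_j (X j @^-1` (A `\` G)).
pose hv (i : 'I_D) x := Y x 0 i.
pose B3 := [set w | 3 * r * q * (n%:R * p / 2) < l2norm (fun i => \sum_(j < n)
  (\1_A (X j w) * (\1_G (X j w) * hv i (X j w))))].
pose hm (ij : 'I_D * 'I_D) x := Y x 0 ij.1 * Y x 0 ij.2 - S ij.1 ij.2.
pose B4' := [set w | 9 / 4 * r ^+ 2 * q * (n%:R * p / 2) < l2norm (fun ij =>
  \sum_(j < n)
  (\1_A (X j w) * (\1_G (X j w) * hm ij (X j w))))].
(* For larger [q] nothing is claimed about the matrix sum. *)
pose B4 := if 12 * q <= 1 then B4' else set0.
have bhm ij : ess_bounded nu (hm ij).
  by apply: ess_boundedB; [exact: ess_boundedM|exact: ess_bounded_cst].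
have ml2 (I : finType) (h : I -> borelRV R D -> R) (a : R) :
    (forall i, measurable_fun setT (h i)) ->
    measurable [set w | a < l2norm (fun i => \sum_(j < n) h i (X j w))].
  move=> mh; rewrite -[Z in measurable Z]setTI; apply: measurable_fun_ltr => //.
  have msqrt : measurable_fun setT (Num.sqrt : R -> R).
    exact: (continuous_measurable_fun (@sqrt_continuous R)).
  apply: (measurableT_comp msqrt); apply: measurable_sum => i.
  apply: measurable_funX; apply: measurable_sum => j.
  exact: measurableT_comp.
have mind (B : set (borelRV R D)) : measurable B ->
    measurable_fun setT (\1_B : borelRV R D -> R).
  by move=> mB; exact: measurable_indic.
have mB1 : measurable B1.
  by apply: (ml2 _ (fun _ x => \1_A x - p)) => _;
    apply: measurable_funB => //; exact: mind.
have mAG : measurable (A `\` G) by exact: measurableD.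
have mB2 : measurable B2.
  apply: fin_bigcup_measurable => // j _.
  by rewrite -[Z in measurable Z]setTI; exact: (measurable_funP (X j)).
have mB3 : measurable B3.
  apply: (ml2 _ (fun i x => \1_A x * (\1_G x * hv i x))) => i.
  apply: measurable_funM; first exact: mind.
  by apply: measurable_funM; [exact: mind|case: (bY i)].
have mB4' : measurable B4'.
  apply: (ml2 _ (fun i x => \1_A x * (\1_G x * hm i x))) => i.
  apply: measurable_funM; first exact: mind.
  by apply: measurable_funM; [exact: mind|case: (bhm i)].
have mB4 : measurable B4 by rewrite /B4; case: ifP.
have PB1 := Bernstein_count hX mA.
have PiAG : Pi (A `\` G) = 0%E.
  have [N [mN N0 sub]] := ae_cond_prob A0 nu_r.
  apply/eqP; rewrite eq_le measure_ge0 andbT -[leRHS]N0.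
  by apply: le_measure; rewrite ?inE// => x [Ax nGx]; apply: sub => /(_ Ax).
have PB2 : P B2 = 0%E.
  apply/eqP; rewrite eq_le measure_ge0 andbT.
  rewrite -[leRHS]/((0 : R)%:E) -[0 : R](mulr0 #|'I_n|%:R).
  apply: probability_bigcup_fin_le => j.
    by rewrite -[Z in measurable Z]setTI; exact: (measurable_funP (X j)).
  by have [hd _] := hX; rewrite hd// PiAG.
(* Here [lambda * U = q / 2] is at most 1/2, and the exponent is [(1/4 - 3/4) * n p q^2 = - s]. *)
have PB3 : (P B3 <= (2 * expR (- s))%:E)%E.
  have := Bernstein_cell hX mG A0 nu_r (h := hv) (U := r) (lambda :=
    q / (2 * r))
    (K := 1) (v := r ^+ 2) (3 * r * q * (n%:R * p / 2)).
  rewrite -/p.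
  have -> : n%:R * (1 * ((q / (2 * r)) ^+ 2 * (p * r ^+ 2))) -
     q / (2 * r) * (3 * r * q * (n%:R * p / 2)) = - s.
    by rewrite -[s](mulKf (_ : 2 != 0 :> R))// -npq; field; exact: lt0r_neq0.
  apply.
  - exact: bY.
  - exact: ltW.
  - move=> x; rewrite /G/= /enorm => xr.
    rewrite -[leLHS]sqr_sqrtr ?ler_pXn2r ?nnegrE ?sqrtr_ge0 ?(ltW r0)//.
    by apply: sumr_ge0 => i _; exact: sqr_ge0.
  - by move=> i; exact: Rintegral_coordB nu_r i.
  - have := covmx_trace_le (ltW r0) nu_r; rewrite -/nu.
    apply: le_trans; rewrite le_eqVlt; apply/orP; left; apply/eqP.
    rewrite Rintegral_sum_bounded; last by move=> i _;
      exact: (ess_boundedX 2 (bY i)).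
    by apply: eq_bigr => i _; rewrite mxE unlock.
  - by rewrite divr_ge0// mulr_ge0// ltW.
  - by [].
  - move=> y y0 yU; apply: expR_le_quadr => //; apply: (le_trans yU).
    rewrite (_ : q / (2 * r) * r = q / 2); last by field; exact: lt0r_neq0.
    by lra.
(* Here [lambda * U = 2 * q] is at most 1/6, and the exponent is [(5/8 - 9/8) * n p q^2 = - s]. *)
have PB4 : (P B4 <= (2 * expR (- s))%:E)%E.
  rewrite /B4; case: ifP => [q12|_]; last first.
    by rewrite measure0 lee_fin mulr_ge0// expR_ge0.
  have := Bernstein_cell hX mG A0 nu_r (h := hm) (U :=
    2 * r ^+ 2) (lambda := q / r ^+ 2)
    (K := 5 / 8) (v := r ^+ 4) (9 / 4 * r ^+ 2 * q * (n%:R * p / 2)).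
  rewrite -/p.
  have -> : n%:R * (5 / 8 * ((q / r ^+ 2) ^+ 2 * (p * r ^+ 4))) -
     q / r ^+ 2 * (9 / 4 * r ^+ 2 * q * (n%:R * p / 2)) = - s.
    by rewrite -[s](mulKf (_ : 2 != 0 :> R))// -npq; field; exact: lt0r_neq0.
  apply.
  - exact: bhm.
  - by rewrite mulr_ge0// sqr_ge0.
  - move=> x xr; have := sum_sqr_centered_le (ltW r0) nu_r xr.
    by rewrite pair_bigA.
  - move=> ij; rewrite RintegralB_bounded;
    [|exact: ess_boundedM|exact: ess_bounded_cst].
    by rewrite Rintegral_prob_cst [S _ _]mxE unlock subrr.
  - rewrite (le_trans _ (Rintegral_sum_sqr_centered (ltW r0) nu_r))//.
    rewrite le_eqVlt; apply/orP; left; apply/eqP.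
    by apply: eq_Rintegral => x _; rewrite pair_bigA.
  - by rewrite divr_ge0// sqr_ge0.
  - by rewrite divr_ge0.
  - move=> y y0 yU; apply: expR_le_quadr_small => //; apply: (le_trans yU).
    rewrite (_ : q / r ^+ 2 * (2 * r ^+ 2) = 2 * q); last by field;
      exact: lt0r_neq0.
    by lra.
have PB2' : (P B2 <= 0%:E)%E by rewrite PB2.
exists (~` (B1 `|` B2 `|` B3 `|` B4)).
have mB12 : measurable (B1 `|` B2) by exact: measurableU.
have mB123 : measurable (B1 `|` B2 `|` B3) by exact: measurableU.
split.
- by apply: measurableC; exact: measurableU.
- rewrite setCK (le_trans (measureU2 _ mB123 mB4))//.
  have -> : 4 * expR (- s) + 2 * expR (- (n%:R * p / 16)) =
    2 * expR (- (n%:R * p / 16)) + 0 + 2 * expR (- s) + 2 * expR (- s) by ring.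
  rewrite EFinD leeD// (le_trans (measureU2 _ mB12 mB3))//.
  rewrite EFinD leeD// (le_trans (measureU2 _ mB1 mB2))//.
  by rewrite EFinD; apply: leeD => //; exact: PB2'.
move=> w nB.
have nB1 : ~ B1 w by move=> ?; apply: nB; do 3 left.
have nB2 : ~ B2 w by move=> ?; apply: nB; do 2 left; right.
have nB3 : ~ B3 w by move=> ?; apply: nB; left; right.
have nB4 : ~ B4 w by move=> ?; apply: nB; right.
have inG i : A (xs w i) -> G (xs w i).
  by move=> Ai; apply: contrapT => nG; apply: nB2; exists i.
(* Outside [B2] every sample point of [A] lies in [G], so the truncation has no effect on the
   sample. *)
have sumE (h : 'rV[R]_D -> R) :
    \sum_(j < n) (\1_A (X j w) * (\1_G (X j w) * h (X j w))) =
    \sum_(j < n | xs w j \in A) h (xs w j).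
  rewrite [RHS]big_mkcond; apply: eq_bigr => j _; rewrite indicE.
  rewrite -/(xs w j); case: ifPn => [|_]; last by rewrite mul0r.
  by rewrite inE => /inG Gj; rewrite mul1r indicE mem_set// mul1r.
split.
- move/negP: nB1; rewrite -leNgt /l2norm big_const card_unit/= addr0 sqrtr_sqr.
  have -> : \sum_(j < n) (\1_A (X j w) - p) = (emp_count A (xs w))%:R -
    n%:R * p.
    rewrite sumrB sumr_const card_ord -[p *+ n]mulr_natl; congr (_ - _).
    transitivity (\sum_(j < n | xs w j \in A) (1 : R));
      last by rewrite sumr_const.
    rewrite [RHS]big_mkcond; apply: eq_bigr => j _; rewrite indicE -/(xs w j).
    by case: (_ \in _).
  by rewrite ler_norml => /andP[]; lra.
- by move=> i /inG.
- move/negP: nB3; rewrite -leNgt; congr (_ <= _).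
  rewrite /l2norm /fnorm fdotE big_ord1; congr Num.sqrt; apply: eq_bigr => i _.
  rewrite sumE -expr2; congr (_ ^+ 2); apply/esym.
  exact: summxE.
- move=> q12; move: nB4; rewrite /B4 q12 => /negP; rewrite -leNgt;
  congr (_ <= _).
  rewrite /l2norm /fnorm fdotE pair_bigA; congr Num.sqrt;
    apply: eq_bigr => ij _.
  rewrite sumE -expr2; congr (_ ^+ 2); apply/esym; rewrite summxE.
  apply: eq_bigr => j _; rewrite [LHS]mxE [X in _ + X]mxE; congr (_ - _).
  by rewrite [LHS]mxE big_ord1 [X in X * _]mxE.
Qed.

End CellEvent.

(** * The support has full measure *)

Section Support.
Context {R : realType} {D : nat} (Pi : probability (borelRV R D) R).

Lemma closed_borelRV (A : set 'rV[R]_D) : closed A -> measurable (A : set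
  (borelRV R D)).
Proof.
move=> cA; rewrite -[A]setCK; apply: measurableC; apply: sub_sigma_algebra.
exact: closed_openC.
Qed.

Lemma measurable_supp : measurable (supp Pi : set (borelRV R D)).
Proof.
by apply: closed_borelRV; apply: closed_bigI => A -[].
Qed.

(** Sup-norm balls with rational centers and radii [1 / (k + 1)]: a countable base of the topology,
    measurable coordinate by coordinate. *)
Definition rat_box (q : 'rV[rat]_D) (k : nat) : set (borelRV R D) :=
  \bigcap_i [set x : borelRV R D |
    `|(x : 'rV[R]_D) 0 i - ratr (q 0 i)| < k.+1%:R^-1].

Lemma measurable_rat_box q k : measurable (rat_box q k).
Proof.
apply: fin_bigcap_measurable => // i _.
rewrite -[X in measurable X]setTI; apply: measurable_fun_ltr => //.
apply: measurableT_comp => //; apply: measurable_funB => //.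
exact: measurable_coord.
Qed.

Lemma rat_box_open_nbhs (U : set 'rV[R]_D) x : open U -> U x ->
  exists q k, rat_box q k x /\ rat_box q k `<=` U.
Proof.
rewrite openE => /[apply] /nbhs_ballP[e /= e0 xeU].
have [k] : exists k, 0 + k.+1%:R^-1 < e / 2.
  by apply: ltr_add_invr; rewrite divr_gt0.
rewrite add0r => ke; set h : R := k.+1%:R^-1 in ke *.
have h0 : 0 < h by rewrite invr_gt0.
have ex_q i : exists q : rat, `|x 0 i - ratr q| < h.
  have /rat_in_itvoo[q] : x 0 i - h < x 0 i + h by lra.
  rewrite in_itv/= => /andP[q1 q2]; exists q.
  by rewrite ltr_norml; apply/andP; split; lra.
have [q qP] := choice ex_q.
exists (\row_i q i), k; split; first by move=> i _ /=; rewrite mxE.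
move=> y xy; apply: xeU; split => // i j; rewrite ord1 -ball_normE /ball_/=.
have := xy j I; rewrite /= mxE -/h => yq; have xq := qP j.
rewrite (_ : x 0 j - y 0 j = (x 0 j - ratr (q j)) - (y 0 j - ratr (q j))).
  by rewrite (le_lt_trans (ler_normB _ _))//; lra.
by ring.
Qed.

(* The complement of the support is a union of countably many null boxes. *)
Lemma ae_supp : {ae Pi, forall x : 'rV[R]_D, supp Pi x}.
Proof.
pose F n : set (borelRV R D) :=
  if unpickle n is Some qk then
    if Pi (rat_box qk.1 qk.2) == 0%E then rat_box qk.1 qk.2 else set0
  else set0.
have nF : Pi.-negligible (\bigcup_n F n).
  apply: negligible_bigcup => n; rewrite /F.
  case: unpickle => [qk|]; last exact: negligible_set0.
  case: ifPn => [/eqP B0|_]; last exact: negligible_set0.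
  by exists (rat_box qk.1 qk.2); split => //; exact: measurable_rat_box.
apply: negligibleS nF => x /= nx.
have [A [cA PA] nAx] : exists2 A : set 'rV[R]_D, closed A /\ Pi A = 1%E & ~ A x.
  apply: contrapT => noA; apply: nx => A AP; apply: contrapT => nAx.
  by apply: noA; exists A.
have [q [k [xB BA]]] := rat_box_open_nbhs (closed_openC cA) nAx.
exists (pickle (q, k)) => //; rewrite /F pickleK /= ifT//.
have mA := closed_borelRV cA.
rewrite eq_le measure_ge0 andbT.
rewrite (@le_trans _ _ (Pi (~` (A : set (borelRV R D)))))//.
  apply: le_measure => //; rewrite inE; first exact: measurable_rat_box.
  exact: measurableC.
by rewrite [leLHS]probability_setC// PA subee.
Qed.

End Support.

(** * Piecewise affine projections and partitions *)

Section AffineProjections.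
Context {R : realType} {D : nat}.
Implicit Types (c delta x : 'rV[R]_D) (V W M : 'M[R]_D).

(** The new residual is the old one, plus the effect of turning the subspace, minus the part of the
    shift orthogonal to [W], which is no longer than the shift. *)
Lemma enorm_sub_affproj_perturb c delta V W x :
  enorm (x - affproj (c + delta) W x) <=
  enorm (x - affproj c V x) +
  fnorm ((x - c) *m (oproj_mx V - oproj_mx W)) + fnorm delta.
Proof.
have [PW _] := oproj_mxP W.
rewrite !enormE !affprojE opprD addrA; set y := x - c.
have -> : y - delta - (y - delta) *m oproj_mx W =
    (y - y *m oproj_mx V) + y *m (oproj_mx V - oproj_mx W) -
    (delta - delta *m oproj_mx W).
  rewrite mulmxBr mulmxBl.
  move: (y *m oproj_mx W) (delta *m oproj_mx W) (y *m oproj_mx V) => u v z.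
  by apply/rowP => i; rewrite !mxE; ring.
rewrite (le_trans (fnormB _ _))// lerD ?fnorm_ortho_projC//.
exact: fnormD.
Qed.

Lemma piecewise_affproj_cell (C : mpartition (borelRV R D))
    (c : 'I_(ncells C) -> 'rV[R]_D) (V : 'I_(ncells C) -> 'M[R]_D) (k :
      'I_(ncells C)) x :
  cell k x -> piecewise_affproj c V x = affproj (c k) (V k) x.
Proof.
move=> kx; rewrite /piecewise_affproj (bigD1 k)//= big1 ?addr0.
  by rewrite indicE mem_set// scale1r.
move=> i ik; rewrite indicE memNset ?scale0r// => ix.
move/eqP: ik; apply; apply: (@cell_trivIset _ _ C) => //.
by exists x.
Qed.

Lemma measurable_affproj c V i : measurable_fun setT
  (fun x : borelRV R D => (x - affproj c V x : 'rV[R]_D) 0 i).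
Proof.
under eq_fun do rewrite affprojE !mxE.
apply: measurable_funB; first by apply: measurable_funB => //;
  exact: measurable_coord.
apply: measurable_sum => l; apply: measurable_funM => //.
exact: measurable_coordB.
Qed.

Lemma measurable_piecewise_affproj (C : mpartition (borelRV R D))
    (c : 'I_(ncells C) -> 'rV[R]_D) (V : 'I_(ncells C) -> 'M[R]_D) :
  measurable_fun setT
    (fun x : borelRV R D => enorm ((x : 'rV[R]_D) - piecewise_affproj c V x)).
Proof.
apply: measurable_enorm => i.
rewrite (_ : (fun x => _) = (fun x : borelRV R D => \sum_(k < ncells C)
    (\1_(cell k) x * ((x : 'rV[R]_D) - affproj (c k) (V k) x) 0 i))).
  apply: measurable_sum => k; apply: measurable_funM.
    by apply: measurable_indic; exact: cell_measurable.
  exact: measurable_affproj.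
apply/funext => x.
have [k _ kx] : (\bigcup_k @cell _ _ C k) x by rewrite (cell_cover C).
rewrite (piecewise_affproj_cell c V kx) (bigD1 k)//= big1 ?addr0.
  by rewrite indicE mem_set// mul1r.
move=> l lk; rewrite indicE memNset ?mul0r// => lx.
move/eqP: lk; apply; apply: (@cell_trivIset _ _ C) => //.
by exists x.
Qed.

End AffineProjections.

Section Partition.
Context d (T : measurableType d) (R : realType) (Pi : probability T R).
Context (C : mpartition T).

Lemma cell_bigsetU : \big[setU/set0]_(k <- enum 'I_(ncells C)) cell k = setT.
Proof.
rewrite -(cell_cover C) -bigcup_seq; congr bigcup; apply/seteqP;
  split => i //= _.
by rewrite mem_enum.
Qed.

Lemma ge0_integral_partition (f : T -> \bar R) : measurable_fun setT f ->
  (forall x, 0 <= f x)%E ->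
  (\int[Pi]_x f x = \sum_(k < ncells C) \int[Pi]_(x in cell k) f x)%E.
Proof.
move=> mf f0; rewrite -{1}cell_bigsetU ge0_integral_bigsetU//.
- by rewrite big_enum.
- exact: cell_measurable.
- exact: enum_uniq.
- by apply: sub_trivIset (cell_trivIset (m := C)).
- exact: measurable_funTS.
Qed.

Lemma sum_cell_probability : (\sum_(k < ncells C) Pi (cell k) = 1)%E.
Proof.
rewrite -(probability_setT Pi) -[in RHS]cell_bigsetU.
rewrite -[RHS]mul1e -integral_cst//; last first.
  by apply: bigsetU_measurable => k _; exact: cell_measurable.
rewrite cell_bigsetU ge0_integral_partition//.
by apply: eq_bigr => k _; rewrite integral_cst ?mul1e//; exact: cell_measurable.
Qed.

End Partition.

(** * Error of the empirical projection in one cell *)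

Section CellError.
Context {R : realType} {D n : nat}.
Variables (A : set 'rV[R]_D) (x : 'I_n -> 'rV[R]_D) (c : 'rV[R]_D).
Variables (S V W : 'M[R]_D) (d : nat) (lam kappa r q N : R).

Let m := emp_count A x.
Let T := \sum_(i < n | x i \in A) ((x i - c)^T *m (x i - c) - S).
Let delta := m%:R^-1 *: \sum_(i < n | x i \in A) (x i - c).

Hypotheses (r0 : 0 < r) (q0 : 0 <= q) (N0 : 0 < N) (lam0 : 0 < lam).
Hypotheses (kappa1 : 1 <= kappa) (lam_kappa : r ^+ 2 <= kappa * lam).
Hypothesis N_m : N <= m%:R.
Hypothesis meanN : fnorm (\sum_(i < n | x i \in A) (x i - c)) <= 3 * r * q * N.
Hypothesis covN : 12 * q <= 1 -> fnorm T <= 9 / 4 * r ^+ 2 * q * N.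
Hypothesis rankV : \rank V = d.
Hypothesis gapV : forall M : 'M[R]_D, ortho_proj M -> \tr M = d%:R ->
  lam / 4 * fdot (oproj_mx V - M) (oproj_mx V - M) <= \tr (S *m (oproj_mx V -
    M)).
Hypothesis pcaW : emp_pca_subspace A x d W.

(** The shift of the mean costs at most [3 * (r * q)], within the allowed [4 * (r * q)]; the turning
    of the subspace costs [12 * kappa * (r * q)]. *)
Lemma cell_emp_error y : enorm (y - c) <= r ->
  enorm (y - affproj (emp_mean A x) W y) <=
  enorm (y - affproj c V y) + (12 * kappa + 4) * (r * q).
Proof.
move=> yr.
have m0 : 0 < m%:R :> R by exact: lt_le_trans N_m.
have mN : (0 < m)%N by rewrite -(ltr0n R).
have [PV trV] := oproj_mxP V; rewrite rankV in trV.
have [PW _] := oproj_mxP W.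
have rq0 : 0 <= r * q by rewrite mulr_ge0// ltW.
have deltaN : fnorm delta <= 3 * (r * q).
  rewrite fnormZ ?invr_ge0 ?(ltW m0)// ler_pdivrMl//.
  rewrite (le_trans meanN)// mulrC -mulrA; apply: ler_wpM2r => //.
  by rewrite mulr_ge0.
rewrite (emp_mean_shift c mN) -/m -/delta.
apply: (le_trans (enorm_sub_affproj_perturb c delta V W y)).
rewrite -addrA lerD2l.
suff : fnorm ((y - c) *m (oproj_mx V - oproj_mx W)) <= 12 * kappa * (r * q).
  by move: deltaN rq0; lra.
(* As kappa >= 1, the difference of two projections being a contraction is
   enough for large q. *)
have [q12|q12] := leP (12 * q) 1; last first.
  rewrite (le_trans (fnorm_ortho_projB _ PV PW))// -enormE (le_trans yr)//.
  have k12 : 1 <= kappa * (12 * q).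
    by rewrite -[leLHS]mulr1; apply: ler_pM => //; exact: ltW.
  by have := ler_wpM2l (ltW r0) k12; lra.
have lam4 : 0 < lam / 4 by rewrite divr_gt0.
have pert := emp_projection_perturbation c mN pcaW PV trV lam4 gapV.
rewrite (le_trans (fnorm_mulmx _ _))// -enormE.
have TN : fnorm T / m%:R <= 9 / 4 * r ^+ 2 * q.
  rewrite ler_pdivrMr// (le_trans (covN q12))//; apply: ler_wpM2l => //.
  by rewrite mulr_ge0// mulr_ge0// sqr_ge0.
(* The square is at most [9 * r ^+ 2 * q ^+ 2], and [12 * q <= 1] trades one factor [q] for 1/12. *)
have d2 : fnorm delta ^+ 2 <= 3 / 4 * r ^+ 2 * q.
  have : fnorm delta ^+ 2 <= (3 * (r * q)) ^+ 2.
    by rewrite ler_pXn2r// nnegrE ?fnorm_ge0// mulr_ge0.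
  have : 0 <= r ^+ 2 * q * (1 - 12 * q).
    by apply: mulr_ge0; [rewrite mulr_ge0// sqr_ge0|rewrite subr_ge0].
  by lra.
have DeltaN : fnorm (oproj_mx V - oproj_mx W) <= 12 * kappa * q.
  apply: (le_trans pert); rewrite ler_pdivrMl//.
  have := ler_wpM2r q0 lam_kappa; lra.
rewrite (_ : 12 * kappa * (r * q) = r * (12 * kappa * q)); last by ring.
by apply: ler_pM => //; [exact: sqrtr_ge0|exact: fnorm_ge0].
Qed.

End CellError.

(** * From the cells to the global errors *)

Section Uniform.
Context {R : realType} {D : nat} (Pi : probability (borelRV R D) R).
Context (C : mpartition (borelRV R D)) (r theta b : R).
Variables (V W : 'I_(ncells C) -> 'M[R]_D) (c' : 'I_(ncells C) -> 'rV[R]_D).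

Let nu (k : 'I_(ncells C)) := cell_prob Pi k.
Let c k := mean (nu k).

Hypothesis A0 : forall k : 'I_(ncells C), Pi (cell k) != 0%E.
Hypothesis nu_r : forall k,
  {ae nu k, forall x : 'rV[R]_D, enorm (x - c k) <= r}.
Hypothesis b0 : 0 <= b.
Hypothesis W_b : forall k y, enorm (y - c k) <= r ->
  enorm (y - affproj (c' k) (W k) y) <= enorm (y - affproj (c k) (V k) y) + b.

Lemma cell_coverP (x : 'rV[R]_D) : exists k : 'I_(ncells C), cell k x.
Proof.
have [k _ kx] : (\bigcup_k @cell _ _ C k) x by rewrite (cell_cover C).
by exists k.
Qed.

Lemma ae_piecewise_affproj_le :
  {ae Pi, forall x : 'rV[R]_D, enorm (x - piecewise_affproj c' W x) <=
    enorm (x - piecewise_affproj c V x) + b}.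
Proof.
have : {ae Pi, forall x : borelRV R D, forall k : 'I_(ncells C), cell k x ->
    enorm ((x : 'rV[R]_D) - c k) <= r}.
  by apply: ae_forall_fin => k; exact: (ae_cond_prob (A0 k) (nu_r k)).
apply: ae_imply => x xr; have [k kx] := cell_coverP x.
by rewrite !(piecewise_affproj_cell _ _ kx) W_b// xr.
Qed.

(** [(g + b)^2 <= 2 g^2 + 2 b^2] is integrated cell by cell, where the mean of [g^2] is the
    population risk. This produces the factors 2 of the final bound. *)
Lemma mean_sq_error_le : (forall k, (pca_risk (nu k) (V k) <= theta%:E)%E) ->
  (mean_sq_error Pi (piecewise_affproj c' W) <= (2 * theta + 2 * b ^+ 2)%:E)%E.
Proof.
move=> riskV.
have mW := measurable_piecewise_affproj c' W.
have mf : measurable_fun setT (fun x : borelRV R D =>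
    (enorm ((x : 'rV[R]_D) - piecewise_affproj c' W x) ^+ 2)%:E).
  by apply/measurable_EFinP; exact: measurable_funX.
have sq_ge0 (y : 'rV[R]_D) : (0 <=
  (enorm y ^+ 2)%:E)%E by rewrite lee_fin sqr_ge0.
have -> : (2 * theta + 2 * b ^+ 2)%:E =
    (\sum_(k < ncells C) Pi (cell k) * (2 * theta + 2 * b ^+ 2)%:E)%E.
  rewrite -ge0_sume_distrl; last by move=> k _; exact: measure_ge0.
  by rewrite sum_cell_probability mul1e.
rewrite /mean_sq_error.
apply: (@le_trans _ _ (\int[Pi]_x
    (enorm ((x : 'rV[R]_D) - piecewise_affproj c' W x) ^+ 2)%:E)%E).
  apply: ge0_subset_integral => //; exact: measurable_supp.
rewrite (ge0_integral_partition Pi C mf)//; apply: lee_sum => k _.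
pose fk (x : borelRV R D) := enorm ((x : 'rV[R]_D) - affproj (c' k) (W k) x).
pose gk (x : borelRV R D) := enorm ((x : 'rV[R]_D) - affproj (c k) (V k) x).
have mfk : measurable_fun setT fk.
  by apply: measurable_enorm => i; exact: measurable_affproj.
have mgk : measurable_fun setT gk.
  by apply: measurable_enorm => i; exact: measurable_affproj.
rewrite (eq_integral (fun x => (fk x ^+ 2)%:E)); last first.
  by move=> x /set_mem kx; rewrite (piecewise_affproj_cell _ _ kx).
have mfk2 : measurable_fun setT (fun x => (fk x ^+ 2)%:E).
  by apply/measurable_EFinP; exact: (measurable_funX 2 mfk).
have mgk2 : measurable_fun setT (fun x => (gk x ^+ 2)%:E).
  by apply/measurable_EFinP; exact: (measurable_funX 2 mgk).
rewrite (ge0_integral_cond_prob (cell_measurable k) (A0 k) mfk2);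
  last by move=> x; exact: sq_ge0.
rewrite fineK ?fin_num_measure//; last exact: cell_measurable.
apply: lee_wpmul2l; first exact: measure_ge0.
apply: (@le_trans _ _ (\int[nu k]_x (2%:E * (gk x ^+ 2)%:E + (2 *
  b ^+ 2)%:E))%E).
  have b2 : (0 <= (2 * b ^+ 2)%:E)%E by rewrite lee_fin mulr_ge0// sqr_ge0.
  apply: ae_ge0_le_integral.
  - exact: measurableT.
  - by move=> x _; exact: sq_ge0.
  - exact: mfk2.
  - by move=> x _; apply: adde_ge0 => //; apply: mule_ge0 => //; exact: sq_ge0.
  - by apply: emeasurable_funD => //; exact: measurable_funeM.
  - move: (nu_r k); apply: ae_imply => x xr _.
    rewrite -EFinM -EFinD lee_fin.
    have := W_b xr; rewrite -/(fk x) -/(gk x) => fg.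
    have : fk x ^+ 2 <= (gk x + b) ^+ 2.
      by rewrite ler_pXn2r// nnegrE ?addr_ge0// sqrtr_ge0.
    by have := sqr_ge0 (gk x - b); lra.
rewrite ge0_integralD//; last 3 first.
- by move=> x _; apply: mule_ge0 => //; exact: sq_ge0.
- exact: measurable_funeM.
- by move=> x _; rewrite lee_fin mulr_ge0// sqr_ge0.
have intb : (\int[nu k]_x (2 * b ^+ 2)%:E <= (2 * b ^+ 2)%:E)%E.
  by rewrite -[leLHS]/(\int[nu k]_x cst (2 * b ^+ 2)%:E x)%E integral_cst//
    -[X in (_ * X)%E]/(nu k setT) probability_setT mule1.
rewrite ge0_integralZl//; last by move=> x _; exact: sq_ge0.
have -> : (2 * theta + 2 * b ^+ 2)%:E = (2%:E * theta%:E + (2 *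
  b ^+ 2)%:E)%E by [].
apply: leeD; last exact: intb.
by apply: lee_wpmul2l => //; have := riskV k; rewrite /pca_risk unlock.
Qed.

End Uniform.

(** * Number of cells and assembly *)

Section Counting.
Context d (T : measurableType d) (R : realType) (Pi : probability T R).
Context (C : mpartition T) (p0 : R).

Lemma ncells_mul_le : (forall k : 'I_(ncells C), (p0%:E <= Pi (cell k))%E) ->
  (ncells C)%:R * p0 <= 1.
Proof.
move=> p0C; rewrite -lee_fin -(sum_cell_probability Pi C).
apply: (@le_trans _ _ (\sum_(k < ncells C) p0%:E)%E); last exact: lee_sum.
by rewrite sumEFin lee_fin sumr_const card_ord mulr_natl.
Qed.

End Counting.

Lemma probability_bigcap_fin_ge d (Omega : measurableType d) (R : realType)
    (P : probability Omega R) (I : finType) (E : I -> set Omega) (b : R) :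
  (forall i, measurable (E i)) -> (forall i, (P (~` E i) <= b%:E)%E) ->
  ((1 - #|I|%:R * b)%:E <= P (\bigcap_i E i))%E.
Proof.
move=> mE PE.
have mI : measurable (\bigcap_i E i) by exact: fin_bigcap_measurable.
have := probability_bigcup_fin_le (fun i => measurableC (mE i)) PE.
rewrite -setC_bigcap probability_setC//.
have : P (\bigcap_i E i) \is a fin_num by exact: fin_num_measure.
by move=> /fineK <-; rewrite -EFinB !lee_fin; lra.
Qed.

(** The uniform estimate comes in two versions because (A2) is an almost sure statement: a point of
    the support may belong to a null part of a cell outside the ball of (A2), where turning the
    subspace is not controlled. Hence a bound at almost every point, and a bound on the whole
    support once the ball condition holds there. The event does not depend on [theta5]. *)
Theorem theorem2 (R : realType) (D d : nat) (hd1 : (1 <= d)%N)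
  (hdD : (d <= D)%N) (Pi : probability (borelRV R D) R)
  (jmin jmax : nat) (hj : (jmin <= jmax)%N)
  (C : nat -> mpartition (borelRV R D))
  (theta1 theta2 theta3 theta4 sigma alpha : R)
  (htheta1 : 0 < theta1) (htheta2 : 0 < theta2) (htheta3 : 0 < theta3)
  (htheta4 : 0 < theta4) (hsigma : 0 <= sigma) (halpha : 0 < alpha)
  (V : forall j, 'I_(ncells (C j)) -> 'M[R]_D)
  (hV : forall j k, (jmin <= j <= jmax)%N ->
     pca_subspace (cell_prob Pi k) d (V j k))
  (A1 : forall j (k : 'I_(ncells (C j))), (jmin <= j <= jmax)%N ->
     ((theta1 * 2 ^- (j * d))%:E <= Pi (cell k))%E)
  (A2 : forall j (k : 'I_(ncells (C j))), (jmin <= j <= jmax)%N ->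
     {ae cell_prob Pi k, forall x : 'rV[R]_D,
        enorm (x - mean (cell_prob Pi k)) <= theta2 * 2 ^- j})
  (lam : forall j, 'I_(ncells (C j)) -> seq R)
  (hlam : forall j k, (jmin <= j <= jmax)%N ->
     ordered_eigenvalues (covmx (cell_prob Pi k)) (lam j k))
  (A3 : forall j k, (jmin <= j <= jmax)%N ->
     [/\ theta3 * (2 ^- (2 * j) / d%:R) <= (lam j k)`_d.-1,
         \sum_(d <= l < D) (lam j k)`_l
           <= theta4 * (sigma ^+ 2 + 2 `^ (- (2 * (1 + alpha) * j%:R)))
       & theta4 * (sigma ^+ 2 + 2 `^ (- (2 * (1 + alpha) * j%:R)))
           <= 2^-1 * (lam j k)`_d.-1])
  (dO : measure_display) (Omega : measurableType dO)
  (P : probability Omega R) (n : nat)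
  (X : 'I_n -> {mfun Omega >-> borelRV R D})
  (hX : iid_sample P Pi X)
  (Vhat : Omega -> forall j, 'I_(ncells (C j)) -> 'M[R]_D)
  (hVhat : forall w j (k : 'I_(ncells (C j))), (jmin <= j <= jmax)%N ->
     emp_pca_subspace (cell k) (fun i => X i w : 'rV[R]_D) d (Vhat w j k)) :
  let Pj j := piecewise_affproj (fun k => mean (cell_prob Pi k)) (V j) in
  let Phat w j := piecewise_affproj
    (fun k : 'I_(ncells (C j)) => emp_mean (cell k) (fun i => X i w : 'rV[R]_D))
    (Vhat w j) in
  let dbar := 4 * d%:R ^+ 2 * theta2 ^+ 4 / theta3 ^+ 2 in
  let c1 := 2 * (12 * Num.sqrt 2 * (theta2 ^+ 3 / (theta3 * Num.sqrt theta1))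
               + 4 * Num.sqrt 2 * (theta2 / (d%:R * Num.sqrt theta1))) ^+ 2 in
  forall (j : nat) (t : R), (jmin <= j <= jmax)%N -> 1 <= t ->
  t + ln (Num.max dbar 8) <= 2^-1 * theta1 * n%:R * 2 ^- (j * d) ->
  let rate := 2 ^- (2 * j) *
    ((t + ln (Num.max dbar 8)) * d%:R ^+ 2 / (n%:R * 2 ^- (j * d))) in
  exists E : set Omega,
  [/\ measurable E,
      ((1 - 2 ^+ (j * d).+1 / theta1 *
          (expR (- t) + expR (- (theta1 / 16 * n%:R * 2 ^- (j * d)))))%:E
        <= P E)%E,
      forall w, E w ->
        (mean_sq_error Pi (Phat w j)
          <= (2 * theta4 * (sigma ^+ 2 + 2 `^ (- (2 * j%:R * (1 + alpha))))
              + c1 * rate)%:E)%E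
    & forall theta5 : R, 0 < theta5 ->
      (* (A4) *)
      (forall i, (jmin <= i <= jmax)%N ->
        (sup_error Pi (Pj i)
          <= (theta5 * (sigma + 2 `^ (- ((1 + alpha) * i%:R))))%:E)%E) ->
      let bound := theta5 * (sigma + 2 `^ (- ((1 + alpha) * j%:R)))
                   + Num.sqrt (c1 / 2 * rate) in
      forall w, E w ->
        {ae Pi, forall x : 'rV[R]_D, enorm (x - Phat w j x) <= bound} /\
        (* the bound of (A2) at the points of cell k that lie in supp Pi *)
        ((forall (k : 'I_(ncells (C j))) (x : 'rV[R]_D),
            supp Pi x -> cell k x ->
            enorm (x - mean (cell_prob Pi k)) <= theta2 * 2 ^- j) ->
         (sup_error Pi (Phat w j) <= bound%:E)%E)].
Proof.
move=> Pj Phat dbar c1 j t hjj t1 ht rate.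
set u : R := 2 ^- j; set v : R := 2 ^- (j * d).
have u0 : 0 < u by rewrite invr_gt0 exprn_gt0.
have v0 : 0 < v by rewrite invr_gt0 exprn_gt0.
have uE : 2 ^- (2 * j) = u ^+ 2 :> R by rewrite mulnC exprM exprVn.
have d0 : 0 < d%:R :> R by rewrite ltr0n.
pose s := t + ln (Num.max dbar 8).
have max1 : 8 <= Num.max dbar 8 by rewrite le_max lexx orbT.
have max0 : 0 < Num.max dbar 8 by exact: lt_le_trans max1.
have ln0 : 0 <= ln (Num.max dbar 8) by rewrite ln_ge0// (le_trans _ max1)//
  ler1n.
have s0 : 0 < s by rewrite /s; lra.
pose theta := theta4 * (sigma ^+ 2 + 2 `^ (- (2 * (1 + alpha) * j%:R))).
pose r := theta2 * u; have r0 : 0 < r by rewrite mulr_gt0.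
pose kappa := d%:R * theta2 ^+ 2 / theta3.
pose p (k : 'I_(ncells (C j))) := fine (Pi (cell k)).
have pE k : Pi (cell k) = (p k)%:E.
  by rewrite fineK// fin_num_measure//; exact: cell_measurable.
have p_ge k : theta1 * v <= p k by rewrite -lee_fin -pE; exact: A1.
have tv0 : 0 < theta1 * v by rewrite mulr_gt0.
have p_gt0 k : 0 < p k by exact: lt_le_trans (p_ge k).
have A0 (k : 'I_(ncells (C j))) : Pi (cell k) != 0%E by rewrite pE eqe gt_eqF.
have n0 : 0 < n%:R :> R.
  rewrite ltr0n lt0n; apply/negP => /eqP n0; move: ht.
  by rewrite n0 mulr0 mul0r -/s leNgt s0.
have sv : 2 * s <= n%:R * (theta1 * v) by move: ht; rewrite -/v -/s; lra.
have ntv0 : 0 < n%:R * (theta1 * v) by rewrite mulr_gt0.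
have s_le k : 2 * s <= n%:R * p k.
  by rewrite (le_trans sv)// ler_pM2l.
pose c (k : 'I_(ncells (C j))) := mean (cell_prob Pi k).
have nu_r k : {ae cell_prob Pi k, forall x : 'rV[R]_D, enorm (x - c k) <= r}.
  exact: A2.
pose lamd k := (lam j k)`_d.-1.
have lamd_ge k : theta3 * u ^+ 2 / d%:R <= lamd k.
  by have [+ _ _] := A3 j k hjj; rewrite uE mulrA.
have lamd0 k : 0 < lamd k.
  by apply: lt_le_trans (lamd_ge k); rewrite divr_gt0// mulr_gt0// exprn_gt0.
have pop k : [/\ lamd k <= \tr (covmx (cell_prob Pi k)),
    (pca_risk (cell_prob Pi k) (V j k) <= theta%:E)%E &
    forall N : 'M[R]_D, ortho_proj N -> \tr N = d%:R ->
    lamd k / 4 * fdot (oproj_mx (V j k) - N) (oproj_mx (V j k) - N) <=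
    \tr (covmx (cell_prob Pi k) *m (oproj_mx (V j k) - N))].
  have [_ tail_le gap] := A3 j k hjj.
  exact: (pca_population (nu_r k) hd1 hdD (hlam j k hjj) (lamd0 k) tail_le gap
    (hV j k hjj)).
pose q (k : 'I_(ncells (C j))) : R := Num.sqrt (2 * s / (n%:R * p k)).
pose q0 := Num.sqrt (2 * s / (n%:R * (theta1 * v))).
have q_le k : q k <= q0.
  have s20 : 0 <= 2 * s by rewrite mulr_ge0// ltW.
  rewrite ler_sqrt; last by rewrite divr_ge0// ltW.
  apply: ler_wpM2l => //; rewrite lef_pV2 ?posrE ?ler_pM2l//.
  by rewrite mulr_gt0.
have lam_kappa k : r ^+ 2 <= kappa * lamd k.
  have -> : r ^+ 2 = kappa * (theta3 * u ^+ 2 / d%:R).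
    by rewrite /r /kappa; field; rewrite !lt0r_neq0.
  by rewrite ler_pM2l// divr_gt0// mulr_gt0// exprn_gt0.
pose b := (12 * kappa + 4) * (r * q0).
have kappa_gt0 : 0 < kappa by rewrite divr_gt0// mulr_gt0// exprn_gt0.
have kappa4 : 0 <= 12 * kappa + 4 by rewrite addr_ge0// mulr_ge0// ltW.
have b0 : 0 <= b by rewrite mulr_ge0// mulr_ge0// ?sqrtr_ge0// ltW.
(* The origin of [c1]: the factor [Num.sqrt 2] and the division by [Num.sqrt theta1] come from [q0],
   and 12 and 4 from the error in a cell. *)
have bE : c1 / 2 * rate = b ^+ 2.
  have sqrt2 : Num.sqrt 2 ^+ 2 = 2 :> R by rewrite sqr_sqrtr.
  have sqrt1 : Num.sqrt theta1 ^+ 2 = theta1 by rewrite sqr_sqrtr// ltW.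
  have sqrt1_neq0 : Num.sqrt theta1 != 0 by rewrite gt_eqF// sqrtr_gt0.
  rewrite /b /q0 !exprMn sqr_sqrtr; last first.
    by rewrite divr_ge0 ?(ltW ntv0)// mulr_ge0// ltW.
  rewrite /c1 /rate -/s -/v uE /r /kappa.
  have -> : 12 * Num.sqrt 2 * (theta2 ^+ 3 / (theta3 * Num.sqrt theta1)) +
      4 * Num.sqrt 2 * (theta2 / (d%:R * Num.sqrt theta1)) =
      Num.sqrt 2 / Num.sqrt theta1 * (theta2 / d%:R *
        (12 * (d%:R * theta2 ^+ 2 / theta3) + 4)).
    by field; rewrite sqrt1_neq0 !lt0r_neq0.
  rewrite (exprMn _ (Num.sqrt 2 / _)) expr_div_n sqrt2 sqrt1.
  by field; rewrite !lt0r_neq0.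
have [E EP] := choice (fun k : 'I_(ncells (C j)) => cell_event hX (A0 k) r0
  (nu_r k) s0 (s_le k)).
have errE w : (\bigcap_k E k) w -> forall k y, enorm (y - c k) <= r ->
    enorm (y - affproj (emp_mean (cell k) (fun i =>
      X i w : 'rV[R]_D)) (Vhat w j k) y)
      <= enorm (y - affproj (c k) (V j k) y) + b.
  move=> Ew k y yr; have [_ _ EkP] := EP k.
  have [cnt _ meanE covE] := EkP w (Ew k I).
  have [lam_tr _ gapV] := pop k.
  (* From [theta3 * u ^+ 2 / d <= lambda_d <= \tr S <= r ^+ 2]. *)
  have kappa1 : 1 <= kappa.
    have := covmx_trace_le (ltW r0) (nu_r k).
    move=> /(le_trans lam_tr) /(le_trans (lamd_ge k)).
    rewrite /r exprMn ler_pdivrMr// => h.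
    rewrite /kappa ler_pdivlMr// mul1r -(@ler_pM2r _ (u ^+ 2)) ?exprn_gt0//.
    by clear - h; lra.
  have [rankV _] := hV j k hjj.
  have := cell_emp_error r0 (sqrtr_ge0 _) _ (lamd0 k) kappa1 (lam_kappa k)
    cnt meanE covE rankV gapV (hVhat w j k hjj) yr.
  have np0 : 0 < n%:R * p k / 2 by rewrite divr_gt0// mulr_gt0.
  move=> /(_ np0) /le_trans; apply; rewrite lerD2l.
  apply: ler_wpM2l => //.
  by rewrite ler_pM2l//; exact: q_le.
exists (\bigcap_k E k); split.
- by apply: fin_bigcap_measurable => // k _; have [] := EP k.
- have PE k : (P (~` E k) <= (2^-1 * expR (- t) +
      2 * expR (- (theta1 / 16 * n%:R * v)))%:E)%E.
    have [_ + _] := EP k; move=> /le_trans; apply; rewrite lee_fin.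
    (* The logarithm in [s] divides [expR (- t)] by at least 8, which absorbs the 4. *)
    have e1 : 4 * expR (- s) <= 2^-1 * expR (- t).
      rewrite /s opprD expRD expRN (expRN (ln _)) lnK ?posrE// mulrCA mulrC.
      rewrite ler_pM2r ?invr_gt0 ?expR_gt0// ler_pdivrMr//.
      by clear - max1; lra.
    have e2 : expR (- (n%:R * p k / 16)) <= expR (- (theta1 / 16 * n%:R * v)).
      rewrite ler_expR lerN2.
      by have h := ler_wpM2l (ltW n0) (p_ge k); clear - h; lra.
    by rewrite -/(p k); clear - e1 e2; lra.
  have mE k : measurable (E k) by have [] := EP k.
  apply: le_trans (probability_bigcap_fin_ge mE PE).
  rewrite lee_fin card_ord.
  have Nv := ncells_mul_le (p0 := theta1 * v) (fun k => A1 j k hjj).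
  have N_le : (ncells (C j))%:R <= 2 ^+ (j * d) / theta1 :> R.
    rewrite ler_pdivlMr//; move: Nv; rewrite mulrA ler_pdivrMr ?exprn_gt0//.
    by rewrite mul1r.
  rewrite lerD2l lerN2 exprS.
  set e := expR (- t); set f := expR _.
  have e0 : 0 <= e by exact: expR_ge0.
  have f0 : 0 <= f by exact: expR_ge0.
  apply: (@le_trans _ _ (2 ^+ (j * d) / theta1 * (2^-1 * e + 2 * f))).
    by apply: ler_wpM2r => //; rewrite addr_ge0// mulr_ge0.
  rewrite -[2 * _ / theta1]mulrA; set K := 2 ^+ (j * d) / theta1.
  have K0 : 0 <= K by rewrite divr_ge0 ?exprn_ge0// ltW.
  have := mulr_ge0 K0 e0; have := mulr_ge0 K0 f0.
  by clear; lra.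
- move=> w Ew.
  have := mean_sq_error_le A0 nu_r b0 (errE w Ew) (theta := theta).
  have -> : 2 * theta4 * (sigma ^+ 2 + 2 `^ (- (2 * j%:R * (1 + alpha)))) +
    c1 * rate =
      2 * theta + 2 * b ^+ 2.
    rewrite -bE /theta; congr (_ + _); last by field.
    by rewrite mulrA (_ : 2 * j%:R * (1 + alpha) = 2 * (1 + alpha) * j%:R)//;
      ring.
  by apply=> k; have [] := pop k.
- move=> theta5 theta50 A4 bound w Ew.
  have boundE : bound = theta5 * (sigma + 2 `^ (- ((1 + alpha) * j%:R))) + b.
    by rewrite /bound bE sqrtr_sqr ger0_norm.
  have Pj_le x : supp Pi x -> enorm (x - Pj j x) <=
      theta5 * (sigma + 2 `^ (- ((1 + alpha) * j%:R))).
    move=> sx; rewrite -lee_fin; apply: le_trans (A4 j hjj).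
    by apply: ereal_sup_ubound; exists x.
  split.
    have := ae_piecewise_affproj_le A0 nu_r (errE w Ew).
    apply: ae_imply2 (ae_supp Pi) => x sx h.
    by rewrite boundE (le_trans h)// lerD2r Pj_le.
  move=> suppr; apply: ub_ereal_sup => _ [x sx <-]; rewrite lee_fin boundE.
  have [k kx] := cell_coverP (C j) x.
  have := Pj_le x sx; rewrite /Phat /Pj !(piecewise_affproj_cell _ _ kx) => h.
  rewrite (le_trans (errE w Ew k x _))//; first exact: suppr.
  by rewrite lerD2r.
Qed.
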